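(* Let $\Omega\subset\mathbb{C}^n$ be a bounded domain with $C^0$-boundary, with associated balls $B(x_j,r_j)$ and unit vectors $w_j$ as in the definition of $C^0$-boundary. Assume that there exist $c\ge1$ and $\epsilon_1<1$ such that $$\delta(z,\partial\Omega)+f(\epsilon)\le\delta(z+\epsilon w_j,\partial\Omega)\le\delta(z,\partial\Omega)+\epsilon$$ whenever $z\in\Omega\cap B(x_j,r_j/c)$ for some $j$ and $0<\epsilon<\epsilon_1$, where $f:\mathbb{R}_+\to\mathbb{R}_+$ is a continuous function satisfying $$\omega(\epsilon):=\frac{\log\frac{\epsilon}{f(\epsilon)}}{\log\frac1\epsilon}>0\quad\text{for }0<\epsilon<\epsilon_1,\qquad \lim_{\epsilon\to0^+}\omega(\epsilon)=0.$$ Then, if $\Omega$ is pseudoconvex, it is also hyperconvex. Moreover, in that case there exist $0<\epsilon_0\le\epsilon_1$, depending on $\Omega,c,\epsilon_1$, a constant $C_1>0$, depending on $\Omega,c,\epsilon_1$, and a bounded plurisubharmonic exhaustion function $w\in C(\overline{\Omega})$ of $\Omega$ satisfying $$-\frac{\log 2}{\log(1/\delta(z))}-C_1\,\omega(\delta(z))\le w(z)\quad\text{for }z\in\Omega\text{ with }\delta(z)\le\epsilon_0.$$ If in addition $f$ is an increasing function, then also $$w(z)\le\frac{\log\frac{f(\epsilon_0)}{\delta(z)+f(\epsilon_0)}}{\log(1/\epsilon_0)}\quad\text{for }z\in\Omega\text{ with }\delta(z)<\epsilon_0.$$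
   Context: A domain is a connected open set. $\mathbb{C}^n$ is identified with $\mathbb{R}^{2n}$, $B(x,r)$ is the open Euclidean ball, $\delta(z,F)$ is the Euclidean distance from $z$ to $F$, and $\delta(z)=\delta(z,\partial\Omega)$. A bounded open set $\Omega\subset\mathbb{R}^m$ has $C^0$-boundary if there exists a finite set of balls $\{B(x_j,r_j)\}$, with $x_j\in\partial\Omega$ and $r_j>0$, that covers an open neighbourhood of $\partial\Omega$ and such that, for each $j$, in an appropriate (Euclidean) coordinate system $y=(y',y_m)$, $$\Omega\cap B(x_j,4r_j)=\{y: y_m>\phi_j(y')\}\cap B(x_j,4r_j),\qquad \partial\Omega\cap B(x_j,4r_j)=\{y: y_m=\phi_j(y')\}\cap B(x_j,4r_j),$$ where $\phi_j:\mathbb{R}^{m-1}\to\mathbb{R}$ is continuous. For $\Omega\subset\mathbb{C}^n$ (so $m=2n$), $w_j\in\partial B(0,1)$ denotes the unit vector of $\mathbb{C}^n$ which is the basis vector $e_{2n}$ in the local coordinates associated with $B(x_j,r_j)$, i.e. the local direction given by the graph. $\mathcal{PSH}(\Omega)$ is the class of plurisubharmonic functions on $\Omega$. $\Omega$ is pseudoconvex if there exists $\phi\in\mathcal{PSH}(\Omega)\cap C(\Omega)$ with $\phi(z)\to+\infty$ as $z\to\partial\Omega$. A bounded plurisubharmonic exhaustion function of $\Omega$ is a function $\phi\in\mathcal{PSH}(\Omega)\cap C(\overline{\Omega})$ with $\phi<0$ in $\Omega$ and $\phi=0$ on $\partial\Omega$; $\Omega$ is hyperconvex if such a function exists.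
   Formalization: It is additionally assumed that the shrunken balls B(x_j, r_j/c) cover the boundary; and when f is increasing, the radius ε_0 at which both bounds hold may depend on f, while C_1, and ε_0 for the lower bound alone, do not depend on f. *)

(* Defs.v *)
(* MathComp-Analysis *)
From HB Require Import structures.
From mathcomp Require Import all_boot all_order all_algebra.
From mathcomp Require Export complex.
From mathcomp Require Import all_classical all_reals all_analysis.

Set Implicit Arguments.
Unset Strict Implicit.
Unset Printing Implicit Defensive.

Import Order.TTheory GRing.Theory Num.Theory.
Import numFieldNormedType.Exports.

Local Open Scope classical_set_scope.
Local Open Scope ring_scope.

(* The regular module R[i]^o carries the canonical (Euclidean) topology of the
   complex plane; n.+1 restricts to dimension at least one. *)
Notation Cplx R := (R[i]^o)%type.
Notation Cn R n := 'rV[R[i]^o]_n.+1.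

Definition boundary (T : topologicalType) (A : set T) : set T :=
  closure A `\` A°.

Definition domain (T : topologicalType) (A : set T) : Prop :=
  open A /\ connected A.

Section Euclidean.
Variables (R : realType) (n : nat).
Implicit Types (x z w : Cn R n) (F Omega : set (Cn R n)).

(* The matrix norm of the library is the sup norm, hence this one. *)
Definition enorm z : R :=
  Num.sqrt (\sum_i (complex.Re (z 0 i) ^+ 2 + complex.Im (z 0 i) ^+ 2)).

Definition eball x (r : R) : set (Cn R n) := [set z | enorm (z - x) < r].

Definition ebounded F : Prop := exists M : R, F `<=` eball 0 M.

(* Only used with nonempty F; inf set0 = 0 by convention. *)
Definition edist z F : R := inf [set enorm (z - x) | x in F].

Definition bdist Omega z : R := edist z (boundary Omega).

Definition realify z : 'rV[R]_(n.+1 + n.+1) :=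
  row_mx (map_mx (@complex.Re R) z) (map_mx (@complex.Im R) z).

(* Near x the set Omega is the strict epigraph of phi in the Euclidean
   coordinates y with origin p and orthonormal frame Q: the columns of Q are
   the basis vectors, y' = col' ord_max y and y_m = y 0 ord_max.  The last
   basis vector of the frame is w. *)
Definition C0_chart Omega x (r : R) w : Prop :=
  exists (p : 'rV[R]_(n.+1 + n.+1)) (Q : 'M[R]_(n.+1 + n.+1))
         (phi : 'rV[R]_(n + n.+1) -> R),
    let y z := (realify z - p) *m Q in
    [/\ Q *m Q^T = 1%:M,
        continuous phi,
        Omega `&` eball x (4 * r) =
          [set z | y z 0 ord_max > phi (col' ord_max (y z))]
            `&` eball x (4 * r),
        boundary Omega `&` eball x (4 * r) =
          [set z | y z 0 ord_max = phi (col' ord_max (y z))]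
            `&` eball x (4 * r) &
        realify w *m Q = delta_mx 0 ord_max].

Definition C0_boundary_data Omega (N : nat) (x : 'I_N -> Cn R n)
    (r : 'I_N -> R) (w : 'I_N -> Cn R n) : Prop :=
  (forall j, [/\ boundary Omega (x j), 0 < r j &
                 C0_chart Omega (x j) (r j) (w j)]) /\
  (exists U : set (Cn R n), [/\ open U, boundary Omega `<=` U &
                                U `<=` \bigcup_j eball (x j) (r j)]).

End Euclidean.

Section Plurisubharmonic.
Variable R : realType.

Definition usc_on (T : topologicalType) (U : set T) (u : T -> \bar R) : Prop :=
  forall z, U z -> forall a : R, (u z < a%:E)%E ->
    \forall y \near z, U y -> (u y < a%:E)%E.

Definition circle (a : Cplx R) (r t : R) : Cplx R :=
  a + (r%:C)%C * (cos t +i* sin t)%C.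

(* The integrand is upper semicontinuous, hence bounded above on the circle,
   so the integral is well defined in [-oo, +oo[; the constant -oo is allowed. *)
Definition subharmonic (U : set (Cplx R)) (u : Cplx R -> \bar R) : Prop :=
  [/\ forall a, U a -> (u a < +oo)%E,
      usc_on U u &
      forall a r, 0 < r ->
        (forall b : Cplx R, `|b - a| <= (r%:C)%C -> U b) ->
        (u a <= ((2 * pi)^-1)%:E *
          \int[@lebesgue_measure R]_(t in `[0%R, (2 * pi)%R])
            u (circle a r t))%E].

Variable n : nat.
Implicit Types (Omega : set (Cn R n)).

Definition psh Omega (u : Cn R n -> \bar R) : Prop :=
  [/\ forall z, Omega z -> (u z < +oo)%E,
      usc_on Omega u &
      forall a b : Cn R n,
        subharmonic [set l : Cplx R | Omega (a + l *: b)]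
                    (fun l => u (a + l *: b))].

(* For bounded Omega; the last clause says that phi z tends to +oo as z tends
   to the boundary. *)
Definition pseudoconvex Omega : Prop :=
  exists phi : Cn R n -> R,
    [/\ psh Omega (EFin \o phi),
        {in Omega, continuous phi} &
        forall M : R, exists2 d : R, 0 < d &
          forall z, Omega z -> bdist Omega z < d -> M < phi z].

(* The values of phi outside the closure of Omega are irrelevant. *)
Definition bounded_psh_exhaustion Omega (phi : Cn R n -> R) : Prop :=
  [/\ psh Omega (EFin \o phi),
      {within closure Omega, continuous phi},
      forall z, Omega z -> phi z < 0 &
      forall z, boundary Omega z -> phi z = 0].

Definition hyperconvex Omega : Prop :=
  exists phi : Cn R n -> R, bounded_psh_exhaustion Omega phi.

End Plurisubharmonic.

Section Modulus.
Variable R : realType.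

Definition omega (f : R -> R) (e : R) : R := ln (e / f e) / ln e^-1.

(* Since e / 0 = 0 and ln 0 = 0, the positivity of omega on ]0, eps1[ entails
   that of f. *)
Definition admissible (eps1 : R) (f : R -> R) : Prop :=
  [/\ {within `[0, +oo[, continuous f},
      forall e, 0 <= e -> 0 <= f e,
      forall e, 0 < e < eps1 -> 0 < omega f e &
      omega f e @[e --> 0^'+] --> 0].

Variable n : nat.

Definition boundary_growth (Omega : set (Cn R n)) (N : nat)
    (x : 'I_N -> Cn R n) (r : 'I_N -> R) (w : 'I_N -> Cn R n)
    (c eps1 : R) (f : R -> R) : Prop :=
  forall (j : 'I_N) (z : Cn R n) (e : R),
    Omega z -> eball (x j) (r j / c) z -> 0 < e < eps1 ->
    bdist Omega z + f e <= bdist Omega (z + (e%:C)%C *: w j)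
                        <= bdist Omega z + e.

End Modulus.

(* Main.v *)
(* Oka: for a polynomial q with |q| < delta on the boundary of a disc, the
   discs z + l b + s q(l) c (0 <= s <= 1, |c| <= 1) cannot leave Omega, by the
   maximum principle for the given exhaustion; letting q approximate exp P,
   with Re P close to log delta on the circle, shows that - log delta is
   plurisubharmonic.

   Gluing (Demailly): near the boundary - log delta (z + e w_j) / log (1/e) - 1
   lies between - log (delta + e) / log (1/e) - 1 and
   omega e - log (1 + delta / f e) / log (1/e), so two such functions differ by
   at most omega e.  Adding a multiple of omega e times
   rho_j^2 - |z - x_j|^2 + |z|^2, which is affine, makes every function be
   dominated where its ball is left.  The supremum over j and 0 < e <= e0,
   truncated at - m0, is the exhaustion; e = delta z gives the lower bound. *)

Require Import Defs.
From mathcomp Require Import all_boot all_order all_algebra.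
From mathcomp Require Import all_classical all_reals all_analysis.
From mathcomp Require Import lra ring.
Import Order.TTheory GRing.Theory Num.Theory.
Import numFieldNormedType.Exports.
Local Open Scope classical_set_scope.
Local Open Scope ring_scope.

Set Implicit Arguments.
Unset Strict Implicit.
Unset Printing Implicit Defensive.

(** Plurisubharmonicity is given on complex lines only and without smoothness, so polynomial discs
    need their own maximum principle. Harmonic functions on a disc occur only as real parts of
    polynomials: their circle means are computed algebraically and they approximate every continuous
    function on the circle, so no Poisson integral enters. A supremum over a continuum of e need not
    be continuous. The family is kept equi-Lipschitz near each point of [Omega], because the growth
    condition gives delta (z + e w_j) >= delta z. The truncation takes over far from the boundary,
    where no ball is available. The upper estimate asks that log (1 + t / f e) / log (1 / e) be
    least at e = e0 among 0 < e <= e0, for all t <= e0. As e decreases, numerator and denominator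
    both grow, so monotonicity of f does not settle this: the endpoint e0 has to be adapted to f,
    whereas [eps0] and [C1] are fixed before f. *)

(** * Means over circles *)

Section CircleMean.
Variable R : realType.
Implicit Types (h k : R -> R) (t : R).

Definition cmean h : R :=
  (2 * pi)^-1 * \int[@lebesgue_measure R]_(t in `[0%R, 2 * pi]) h t.

Lemma pi2_gt0 : 0 < 2 * pi :> R.
Proof. by rewrite mulr_gt0 ?pi_gt0. Qed.

Lemma integrable_cont h a b : continuous h ->
  (@lebesgue_measure R).-integrable `[a, b] (EFin \o h).
Proof.
move=> ch; apply: continuous_compact_integrable; first exact: segment_compact.
exact: continuous_subspaceT.
Qed.

Lemma cmeanE h : continuous h ->
  (((2 * pi)^-1)%:E * \int[@lebesgue_measure R]_(t in `[0%R,
    (2 * pi)%R]) (h t)%:E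
   = (cmean h)%:E)%E.
Proof.
move=> ch; rewrite /cmean /Rintegral EFinM fineK//.
by apply: integrable_fin_num => //; exact: integrable_cont.
Qed.

Lemma cmeanD h k : continuous h -> continuous k ->
  cmean (fun t => h t + k t) = cmean h + cmean k.
Proof.
move=> ch ck; rewrite /cmean RintegralD// ?mulrDr//; exact: integrable_cont.
Qed.

Lemma cmeanZ c h : continuous h -> cmean (fun t => c * h t) = c * cmean h.
Proof.
move=> ch; rewrite /cmean RintegralZl//; last exact: integrable_cont.
by rewrite mulrCA.
Qed.

Lemma cmeanB h k : continuous h -> continuous k ->
  cmean (fun t => h t - k t) = cmean h - cmean k.
Proof.
move=> ch ck; rewrite /cmean RintegralB// ?mulrBr//; exact: integrable_cont.
Qed.

Lemma le_cmean h k : continuous h -> continuous k ->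
  (forall t, 0 <= t <= 2 * pi -> h t <= k t) -> cmean h <= cmean k.
Proof.
move=> ch ck hk; rewrite /cmean ler_pM2l ?invr_gt0 ?pi2_gt0//.
by apply: le_Rintegral => //; exact: integrable_cont.
Qed.

Lemma cmean_FTC (h H : R -> R) : continuous h ->
  (forall t, is_derive t 1 H (h t)) -> H (2 * pi) = H 0 -> cmean h = 0.
Proof.
move=> ch dH H0; rewrite /cmean /Rintegral.
have cH : continuous H.
  move=> t; apply: differentiable_continuous; apply/derivable1_diffP.
  by have [] := dH t.
rewrite (@continuous_FTC2 _ h H)//.
- by rewrite H0 subee//= mulr0.
- exact: pi2_gt0.
- exact: continuous_subspaceT.
- split => //.
  + exact/cvg_at_right_filter/cH.
  + exact/cvg_at_left_filter/cH.
- by move=> t _; rewrite derive1E; apply: derive_val.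
Qed.

Lemma cmean_cst c : cmean (fun=> c) = c.
Proof.
have c1 : cmean (fun=> 1) = 1.
  rewrite /cmean /Rintegral (@continuous_FTC2 _ _ id)//.
  - by rewrite /= oppr0 addr0 mulVf// gt_eqF// pi2_gt0.
  - exact: pi2_gt0.
  - by apply: continuous_subspaceT => ?; exact: cvg_cst.
  - split => //; first exact/cvg_at_right_filter/cvg_id.
    exact/cvg_at_left_filter/cvg_id.
  - by move=> t _; rewrite derive1E derive_id.
have := @cmeanZ c (fun=> 1) (fun t => cvg_cst _).
by rewrite c1 mulr1 => {2}<-; congr cmean; apply/funext => t; rewrite mulr1.
Qed.

End CircleMean.

(** * Circle means of complex polynomials *)

Section CirclePoly.
Variable R : realType.
Implicit Types (h k : R -> R) (t : R) (p q : {poly R[i]}).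
Local Notation Re := (@complex.Re R).
Local Notation Im := (@complex.Im R).

Definition cis t : R[i] := (cos t +i* sin t)%C.

Lemma Re_mul (a b : R[i]) : Re (a * b) = Re a * Re b - Im a * Im b.
Proof. by case: a b => [? ?] [? ?]. Qed.

Lemma Im_mul (a b : R[i]) : Im (a * b) = Re a * Im b + Im a * Re b.
Proof. by case: a b => [? ?] [? ?]. Qed.

Lemma Re_add (a b : R[i]) : Re (a + b) = Re a + Re b.
Proof. by case: a b => [? ?] [? ?]. Qed.

Lemma Im_add (a b : R[i]) : Im (a + b) = Im a + Im b.
Proof. by case: a b => [? ?] [? ?]. Qed.

Lemma Re_opp (a : R[i]) : Re (- a) = - Re a.
Proof. by case: a. Qed.

Lemma Im_opp (a : R[i]) : Im (- a) = - Im a.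
Proof. by case: a. Qed.

Lemma Re_real (a : R) : Re (a%:C)%C = a. Proof. by []. Qed.

Lemma Im_real (a : R) : Im (a%:C)%C = 0. Proof. by []. Qed.

Definition complexE := (Re_mul, Im_mul, Re_add, Im_add, Re_opp, Im_opp,
  Re_real, Im_real).

Lemma cisX t n : cis t ^+ n = cis (n%:R * t).
Proof.
elim: n => [|n IH]; first by rewrite expr0 mul0r /cis cos0 sin0.
rewrite exprS IH /cis -natr1 mulrDl mul1r cosD sinD.
by apply/eqP; rewrite eq_complex /=; apply/andP; split; apply/eqP; ring.
Qed.

Lemma cis2pi : cis (2 * pi) = 1.
Proof. by rewrite /cis mulr_natl cos2pi sin2pi. Qed.

Lemma horner_continuous (T : topologicalType) (f : T -> R[i]) p (x : T) :
  Re (f y) @[y --> x] --> Re (f x) -> Im (f y) @[y --> x] --> Im (f x) ->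
  Re p.[f y] @[y --> x] --> Re p.[f x] /\ Im p.[f y] @[y --> x] --> Im p.[f x].
Proof.
move=> cr ci; elim/poly_ind: p => [|p c [IHr IHi]].
  by split; under eq_fun do rewrite horner0; rewrite horner0; exact: cvg_cst.
split.
  under eq_fun do rewrite hornerMXaddC Re_add Re_mul.
  rewrite hornerMXaddC Re_add Re_mul.
  apply: cvgD; last exact: cvg_cst.
  by apply: cvgB; apply: cvgM.
under eq_fun do rewrite hornerMXaddC Im_add Im_mul.
rewrite hornerMXaddC Im_add Im_mul.
apply: cvgD; last exact: cvg_cst.
by apply: cvgD; apply: cvgM.
Qed.

Lemma continuous_horner_cis (r : R) p :
  continuous (fun t => Re p.[(r%:C)%C * cis t]) /\
  continuous (fun t => Im p.[(r%:C)%C * cis t]).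
Proof.
have cr t : Re ((r%:C)%C * cis y) @[y --> t] --> Re ((r%:C)%C * cis t).
  under eq_fun do rewrite Re_mul /= mul0r subr0; rewrite Re_mul /= mul0r subr0.
  by apply: cvgM; [exact: cvg_cst|exact: continuous_cos].
have ci t : Im ((r%:C)%C * cis y) @[y --> t] --> Im ((r%:C)%C * cis t).
  under eq_fun do rewrite Im_mul /= mul0r addr0; rewrite Im_mul /= mul0r addr0.
  by apply: cvgM; [exact: cvg_cst|exact: continuous_sin].
by split=> t; have [] := horner_continuous p (cr t) (ci t).
Qed.

Lemma continuous_cosZ (m : R) : continuous (fun t => cos (m * t)).
Proof.
move=> t; apply: (@continuous_comp _ _ _ (fun t => m * t) cos).
  by apply: cvgM; [exact: cvg_cst|exact: cvg_id].
exact: continuous_cos.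
Qed.

Lemma continuous_sinZ (m : R) : continuous (fun t => sin (m * t)).
Proof.
move=> t; apply: (@continuous_comp _ _ _ (fun t => m * t) sin).
  by apply: cvgM; [exact: cvg_cst|exact: cvg_id].
exact: continuous_sin.
Qed.

Lemma cmean_cisX (c : R[i]) n :
  cmean (fun t => Re (c * cis t ^+ n)) = if n is 0%N then Re c else 0.
Proof.
case: n => [|n].
  by under eq_fun do rewrite expr0 mulr1; exact: cmean_cst.
under eq_fun do rewrite cisX Re_mul /=.
apply: (@cmean_FTC _ _ (fun t =>
  n.+1%:R^-1 * (Re c * sin (n.+1%:R * t) + Im c * cos (n.+1%:R * t)))).
- by move=> t; apply: cvgB; (apply: cvgM; [exact: cvg_cst|]);
    [exact: continuous_cosZ|exact: continuous_sinZ].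
- move=> t.
  have dm : is_derive t 1 (fun t : R => n.+1%:R * t : R) n.+1%:R.
    by apply: is_derive_eq; rewrite ?scaler0 ?add0r; apply: mulr1.
  set m : R := n.+1%:R; rewrite -/m in dm.
  pose S t := sin (m * t); pose C t := cos (m * t).
  have dS : is_derive t 1 S (cos (m * t) * m).
    by apply: (@is_derive1_comp _ sin (fun t => m * t)).
  have dC : is_derive t 1 C (- sin (m * t) * m).
    by apply: (@is_derive1_comp _ cos (fun t => m * t)).
  have m0 : m != 0 by rewrite pnatr_eq0.
  change (is_derive t 1 (m^-1 \*: (Re c \*: S + Im c \*: C))
            (Re c * cos (m * t) - Im c * sin (m * t))).
  apply: is_derive_eq; rewrite /GRing.scale /=.
  by field.
- have [-> ->] : cos (n.+1%:R * (2 * pi)) = 1 :> R /\ sin (n.+1%:R * (2 * pi))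
    = 0 :> R.
    by have := cisX (2 * pi) n.+1; rewrite cis2pi expr1n => -[<- <-].
  by rewrite [n.+1%:R * 0]mulr0 cos0 sin0.
Qed.

Lemma cmean_poly p (r : R) :
  cmean (fun t => Re p.[(r%:C)%C * cis t]) = Re p.[0].
Proof.
(* The extra factor [cis t ^+ n] carries the induction: Horner's step turns [p * 'X] into the power
   n + 1, whose mean is 0 whatever p is. *)
have H : forall n, cmean (fun t => Re (p.[(r%:C)%C * cis t] * cis t ^+ n)) =
    if n is 0%N then Re p.[0] else 0.
  elim/poly_ind: p => [|p c IH] n.
    by rewrite horner0; under eq_fun do rewrite horner0 mul0r;
      rewrite cmean_cst; case: n.
  have cX (q : {poly R[i]}) m : continuous (fun t =>
    Re (q.[(r%:C)%C * cis t] * cis t ^+ m)).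
    have -> : (fun t => Re (q.[(r%:C)%C * cis t] * cis t ^+ m)) =
       (fun t => Re q.[(r%:C)%C * cis t] * cos (m%:R * t) - Im q.[(r%:C)%C *
         cis t] * sin (m%:R * t)).
      by apply/funext => t; rewrite Re_mul cisX.
    have [c1 c2] := continuous_horner_cis r q.
    by move=> t; apply: cvgB; apply: cvgM;
       [exact: c1|exact: continuous_cosZ|exact: c2|exact: continuous_sinZ].
  transitivity (r * cmean (fun t => Re (p.[(r%:C)%C * cis t] * cis t ^+ n.+1)) +
                cmean (fun t => Re (c * cis t ^+ n))).
    have c1 := cX p n.+1.
    have c2 : continuous (fun t => Re (c * cis t ^+ n)).
      by have := cX c%:P n; under eq_fun do rewrite hornerC.
    have c3 : continuous (fun t =>
      r * Re (p.[(r%:C)%C * cis t] * cis t ^+ n.+1)).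
      by move=> t; apply: cvgM; [exact: cvg_cst|exact: c1].
    rewrite -cmeanZ// -cmeanD//.
    congr cmean; apply/funext => t; rewrite hornerMXaddC mulrDl Re_add;
      congr (_ + _).
    rewrite exprS; set u := _.[_].
    have -> : u * ((r%:C)%C * cis t) * cis t ^+ n = (r%:C)%C * (u * (cis t *
      cis t ^+ n)).
      by rewrite mulrCA !mulrA.
    by rewrite Re_mul Re_real Im_real mul0r subr0.
  by rewrite IH mulr0 add0r cmean_cisX; case: n => //;
    rewrite hornerMXaddC mulr0 add0r.
by rewrite -(H 0%N); congr cmean; apply/funext => t; rewrite expr0 mulr1.
Qed.

End CirclePoly.

(** * Trigonometric approximation *)

Section TrigApprox.
Variable R : realType.
Implicit Types (f g h : R -> R) (s t : R) (p q : {poly R[i]}).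
Local Notation Re := (@complex.Re R).
Local Notation Im := (@complex.Im R).
Local Notation cis := (@cis R).

(** Writing a trigonometric polynomial as the real part of a holomorphic polynomial supplies its
    harmonic extension to the disc at once. *)
Definition trig_poly f := exists p, forall t, Re p.[cis t] = f t.

Lemma trig_polyD f g : trig_poly f -> trig_poly g ->
  trig_poly (fun t => f t + g t).
Proof.
by move=> [p pf] [q qg]; exists (p + q) => t; rewrite hornerD Re_add pf qg.
Qed.

(* On the unit circle [Re a * Re (c z) = Re (a c z + a c^* / z) / 2], and the
   constant coefficient of a is moved to the conjugate side. *)
Lemma trig_polyM f (c : R[i]) : trig_poly f ->
  trig_poly (fun t => f t * Re (c * cis t)).
Proof.
move=> [p pf]; elim/poly_ind: p pf => [|p c0 _] pf.
  by exists 0 => t; rewrite -pf !horner0 /= mul0r.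
exists (((2^-1)%:C)%C *: ((p * 'X + c0%:P) * c%:P * 'X + p * (c^*)%C%:P
          + (c0^* * c)%C%:P * 'X)) => t.
rewrite -pf !hornerE ; set u := p.[_].
have H : cos t ^+ 2 + sin t ^+ 2 = 1 by exact: cos2Dsin2.
rewrite !complexE /=.
case: u => a b; case: c => c d; case: (c0) => e g /=.
set x := cos t in H *; set y := sin t in H *.
have -> : (a * c - b * - d) = (a * c - b * - d) * (x ^+ 2 + y ^+ 2).
  by rewrite H mulr1.
have -> : (a * - d + b * c) = (a * - d + b * c) * (x ^+ 2 + y ^+ 2).
  by rewrite H mulr1.
by field.
Qed.

Lemma continuous_kernel t N : continuous (fun s => (1 + cos (t - s)) ^+ N).
Proof.
have c1 : continuous (fun s => 1 + cos (t - s)).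
  move=> s; apply: cvgD; first exact: cvg_cst.
  apply: (@continuous_comp _ _ _ (fun s => t - s) cos).
    by apply: cvgB; [exact: cvg_cst|exact: cvg_id].
  exact: continuous_cos.
move=> s; apply: (@continuous_comp _ _ _ (fun s =>
  1 + cos (t - s)) (fun x => x ^+ N)).
  exact: c1.
exact: exprn_continuous.
Qed.

Lemma continuous_fmul f g : continuous f -> continuous g ->
  continuous (fun t => f t * g t).
Proof. by move=> cf cg t; apply: cvgM; [exact: cf|exact: cg]. Qed.

Lemma continuous_cmul (c : R) f : continuous f -> continuous (fun t => c * f t).
Proof. by move=> cf t; apply: cvgM; [exact: cvg_cst|exact: cf]. Qed.

(** Since 1 + cos (t - s) = 1 + cos t cos s + sin t sin s, one power of the kernel is traded for the
    weights g, g cos and g sin; hence the generality in g. *)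
Lemma trig_poly_kernel N g : continuous g ->
  trig_poly (fun t => cmean (fun s => g s * (1 + cos (t - s)) ^+ N)).
Proof.
elim: N g => [|N IH] g cg.
  exists ((cmean g)%:C)%C%:P => t; rewrite hornerC Re_real.
  by congr cmean; apply/funext => s; rewrite expr0 mulr1.
have cgc := continuous_fmul cg (@continuous_cos R).
have cgs := continuous_fmul cg (@continuous_sin R).
(* The multipliers 1 and -i produce cos t and sin t as real parts. *)
have [p Hp] := trig_polyD (trig_polyD (IH _ cg) (trig_polyM 1 (IH _ cgc)))
                          (trig_polyM (0 -i* 1)%C (IH _ cgs)).
exists p => t; rewrite {}Hp; cbv beta. rewrite !Re_mul /=.
set a := (_ * cos t - _); set b := (_ * cos t - _).
have -> : a = cos t by rewrite /a mul1r mul0r subr0.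
have -> : b = sin t by rewrite /b mul0r sub0r mulN1r opprK.
have cK := @continuous_kernel t N.
have c1 := continuous_fmul cg cK; have c2 := continuous_fmul cgc cK.
have c3 := continuous_fmul cgs cK.
rewrite [cmean _ * cos t]mulrC [cmean _ * sin t]mulrC.
rewrite -(cmeanZ _ c2) -(cmeanZ _ c3).
rewrite -(cmeanD c1 (continuous_cmul c2)) -cmeanD;
  last exact: (continuous_cmul c3).
- by congr cmean; apply/funext => s; rewrite exprS cosB; ring.
- by move=> s; apply: cvgD; [exact: c1|exact: (continuous_cmul c2)].
Qed.

(** The difference of the two sides is the mean of the derivative of the periodic function - sin (t
    - s) (1 + cos (t - s)) ^ N. *)
Lemma cmean_kernelS t N :
  N.+1%:R * cmean (fun s => (1 + cos (t - s)) ^+ N.+1) =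
  (N.*2.+1)%:R * cmean (fun s => (1 + cos (t - s)) ^+ N).
Proof.
have cK := @continuous_kernel t.
have c1 := @continuous_cmul N.+1%:R _ (cK N.+1).
have c2 := @continuous_cmul N.*2.+1%:R _ (cK N).
apply/eqP; rewrite -subr_eq0 -!cmeanZ// -cmeanB//.
apply/eqP.
apply: (@cmean_FTC _ _ (fun s => - (sin (t - s) * (1 + cos (t - s)) ^+ N))).
- by move=> s; apply: cvgB; [exact: c1|exact: c2].
- move=> s.
  pose S s := sin (t - s); pose C s := cos (t - s).
  have dm : is_derive s 1 (fun s => t - s) (-1).
    by apply: is_derive_eq; rewrite add0r mul1r.
  have dS : is_derive s 1 S (cos (t - s) * (-1)).
    by apply: (@is_derive1_comp _ sin (fun s => t - s)).
  have dC : is_derive s 1 C (- sin (t - s) * (-1)).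
    by apply: (@is_derive1_comp _ cos (fun s => t - s)).
  have EX n r : ((cst 1 + C) ^+ n) r = (1 + cos (t - r)) ^+ n.
    by elim: n => [|n IH]; rewrite ?expr0// !exprS -IH.
  have -> : (fun s => - (sin (t - s) * (1 + cos (t - s)) ^+ N)) = - (S * (cst 1
    + C) ^+ N).
    by apply/funext => r; rewrite -EX.
  apply: is_derive_eq; rewrite /GRing.scale /= EX.
  have -> : (cst 1 + C) s = 1 + cos (t - s) by [].
  have -> : S s = sin (t - s) by [].
  have H : cos (t - s) ^+ 2 + sin (t - s) ^+ 2 = 1 by exact: cos2Dsin2.
  set x := cos _ in H *; set y := sin _ in H *.
  have y2 : y ^+ 2 = (1 - x) * (1 + x) by rewrite -[_ ^+ 2](addKr (x ^+ 2)) H;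
    ring.
  have -> : y * (N%:R * (1 + x) ^+ N.-1 * (0 + - y * -1)) = N%:R * (1 - x) * (1
    + x) ^+ N.
    transitivity (N%:R * (1 + x) ^+ N.-1 * y ^+ 2); first by ring.
    by rewrite y2; case: (N) => [|n]; rewrite ?mul0r//= exprS; ring.
  have -> : N.*2.+1%:R = 2 * N%:R + 1 :> R by rewrite -natr1 -mul2n natrM.
  by rewrite -natr1 exprS; ring.
- by rewrite subr0 !(sinB, cosB) mulr_natl cos2pi sin2pi !(mulr0, mulr1,
    subr0, addr0).
Qed.


(** The recurrence has the same coefficients for every t, which stands in for translation invariance
    of the integral over a period. *)
Lemma kernel_mean N t :
  cmean (fun s => (1 + cos (t - s)) ^+ N) = cmean (fun s =>
    (1 + cos (0 - s)) ^+ N) /\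
  0 < cmean (fun s => (1 + cos (t - s)) ^+ N).
Proof.
elim: N => [|N [IHe IHp]].
  have H0 u : cmean (fun s => (1 + cos (u - s)) ^+ 0) = 1.
    by rewrite -[RHS](@cmean_cst R 1); congr cmean; apply/funext => s;
      rewrite expr0.
  by rewrite !H0.
have S0 : 0 < N.+1%:R :> R by rewrite ltr0n.
have H u : cmean (fun s => (1 + cos (u - s)) ^+ N.+1) =
  (N.*2.+1)%:R / N.+1%:R * cmean (fun s => (1 + cos (u - s)) ^+ N).
  by rewrite mulrAC -cmean_kernelS mulrAC mulfV ?mul1r// gt_eqF.
by rewrite !H IHe; split=> //; rewrite -IHe mulr_gt0// divr_gt0// ltr0n.
Qed.

(** The modulus is expressed through 1 - cos because the kernel integrates that explicitly. Near the
    diagonal uniform continuity gives e; away from it 1 - cos is bounded below and C absorbs twice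
    the bound of h. *)
Lemma circle_modulus h (e : R) : continuous h -> periodic h (2 * pi) -> 0 < e ->
  exists2 C : R, 0 <= C & forall s t, 0 <= s <= 2 * pi -> - pi <= t <= pi ->
    `|h s - h t| <= e + C * (1 - cos (t - s)).
Proof.
move=> ch ph e0.
have pi0 := pi_gt0 R.
(* The interval reaches 3 pi because t may be moved by one period to come within pi of s. *)
have cK : compact (`[- pi, 3 * pi]%classic : set R) by exact: segment_compact.
have [B hB] : exists B, forall x, - pi <= x <= 3 * pi -> `|h x| <= B.
  have le3 : - pi <= 3 * pi :> R by lra.
  have ca : {within `[- pi, 3 * pi], continuous (fun x => `|h x|)}.
    by apply: continuous_subspaceT => x; apply: cvg_norm; exact: ch.
  by have [c _ hc] := EVT_max le3 ca; exists `|h c| => x xI; apply: hc;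
    rewrite in_itv.
have [d d0 hd] : exists2 d, 0 < d & forall x y, - pi <= x <= 3 * pi ->
    `|x - y| < d -> `|h x - h y| < e.
  have /compact_near_coveringP := cK.
  move=> /(_ R (0 : R)^'+ (fun d x =>
    forall y, `|x - y| < d -> `|h x - h y| < e)).
  case.
    move=> x _.
    have /cvgrPdist_lt /(_ (e / 2)) := ch x.
    rewrite divr_gt0// => /(_ isT) /nbhs_ballP[r /= r0 hr].
    exists (ball x (r / 2), [set d | d < r / 2]).
      split=> /=; first by apply: nbhsx_ballx; rewrite divr_gt0.
      by apply: nbhs_right_lt; rewrite divr_gt0.
    move=> [x' d'] /= [xx' d'r] y x'y.
    have h1 : `|h x - h x'| < e / 2.
      apply: hr; rewrite /ball /= in xx' *; apply: lt_trans xx' _.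
      by rewrite ltr_pdivrMr// ltr_pMr// ltr1n.
    have h2 : `|h x - h y| < e / 2.
      apply: hr; rewrite /ball /= in xx' *.
      rewrite (_ : x - y = (x - x') + (x' - y)); last by ring.
      rewrite (le_lt_trans (ler_normD _ _))// [r]splitr ltrD//.
      exact: lt_trans x'y d'r.
    rewrite (_ : h x' - h y = (h x - h y) - (h x - h x')); last by ring.
    by rewrite (le_lt_trans (ler_normB _ _))// [e]splitr ltrD.
  move=> d /= d0 hd; exists (d / 2); first by rewrite divr_gt0.
  move=> x y xI xy; apply: (hd (d / 2)) => //=.
  - by rewrite sub0r normrN gtr0_norm ?divr_gt0// ltr_pdivrMr// ltr_pMr// ltr1n.
  - by rewrite divr_gt0.
have d'E : exists2 d', 0 < d' <= pi & d' <= d.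
  exists (Num.min d pi); last by rewrite ge_min lexx.
  by rewrite lt_min d0 pi0 ge_min lexx orbT.
have [d' /andP[d'0 d'pi] d'd] := d'E.
have cd' : 0 < 1 - cos d'.
  rewrite subr_gt0 -cos0 ltr_cos// in_itv/= ?lexx ?(ltW pi0)//.
  by rewrite (ltW d'0) d'pi.
have B0 : 0 <= B by apply: le_trans (hB 0 _); [exact: normr_ge0|lra].
exists (2 * B / (1 - cos d')); first by rewrite divr_ge0// ?mulr_ge0// ltW.
suff H s t : 0 <= s <= 2 * pi -> - pi <= t <= 3 * pi -> `|t - s| <= pi ->
    `|h s - h t| <= e + 2 * B / (1 - cos d') * (1 - cos (t - s)).
  move=> s t sI tI; have [ts|ts] := leP (- pi) (t - s).
    by apply: H => //; [lra|rewrite ler_norml; lra].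
  have -> : cos (t - s) = cos ((t + 2 * pi) - s).
    by rewrite addrAC [2 * pi]mulrC mulr_natr cosD2pi.
  by rewrite -(ph t); apply: H => //; [lra|rewrite ler_norml; lra].
move=> sI tI ts.
have cle : 0 <= 1 - cos (t - s) by rewrite subr_ge0 cos_le1.
have [tsd|tsd] := ltP `|t - s| d'.
  rewrite (@le_trans _ _ e)//.
    apply/ltW/hd; first by lra.
    by rewrite distrC; apply: lt_le_trans d'd.
  by rewrite lerDl mulr_ge0// divr_ge0 ?mulr_ge0// ltW.
have h1 : 1 - cos d' <= 1 - cos (t - s).
  rewrite lerD2l lerN2 -(cos_norm (t - s)).
  have [->//|ne] := eqVneq d' `|t - s|.
  by apply/ltW; rewrite ltr_cos ?in_itv/= ?normr_ge0 ?(ltW d'0)// lt_neqAle ne.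
rewrite (@le_trans _ _ (2 * B))//.
  rewrite (le_trans (ler_normB _ _))// mulr_natl mulr2n lerD// hB//; lra.
rewrite (@le_trans _ _ (2 * B / (1 - cos d') * (1 - cos d')))//.
  by rewrite divfK// gt_eqF.
rewrite (@le_trans _ _ (2 * B / (1 - cos d') * (1 - cos (t - s))))//.
  by rewrite ler_wpM2l// divr_ge0 ?mulr_ge0// ltW.
by rewrite lerDr ltW.
Qed.

(* Korovkin: the normalized positive kernel [(1 + cos (t - s)) ^ N] integrates
   [1 - cos (t - s)] to [1 / (N + 1)]. *)
Lemma trig_approx_period h (e : R) : continuous h -> periodic h (2 * pi) ->
  0 < e ->
  exists p, forall t, - pi <= t <= pi -> `|Re p.[cis t] - h t| <= e.
Proof.
move=> ch ph e0.
have e20 : 0 < e / 2 by rewrite divr_gt0.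
have [C C0 hC] := circle_modulus ch ph e20.
have [N hN] : exists N : nat, C / N.+1%:R <= e / 2.
  exists (Num.trunc (C / (e / 2))).
  rewrite ler_pdivrMr ?ltr0n// mulrC -ler_pdivrMr//.
  exact/ltW/truncnS_gt.
set c := cmean (fun s => (1 + cos (0 - s)) ^+ N).
have [_ c0] := kernel_mean N 0; rewrite -/c in c0.
have [p hp] := trig_poly_kernel N (@continuous_cmul c^-1 _ ch).
exists p => t tpi; rewrite hp.
pose W n s := (1 + cos (t - s)) ^+ n.
have cW n : continuous (W n) by exact: continuous_kernel.
have mW : cmean (W N) = c by have [] := kernel_mean N t.
(* By the recurrence, with (2N + 1) / (N + 1) = 2 - 1 / (N + 1). As 1 - cos = 2 - (1 + cos), the
   mean error is C / (N + 1), which N was chosen to keep below e / 2. *)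
have mS : cmean (W N.+1) = (2 - N.+1%:R^-1) * c.
  apply: (@mulfI _ N.+1%:R); first by rewrite pnatr_eq0.
  rewrite cmean_kernelS mW [RHS]mulrA mulrBr mulfV ?pnatr_eq0//; congr (_ * _).
  by rewrite -natr1 -[N.+1%:R]natr1 -muln2 natrM; ring.
have c1 : continuous (fun s => h s * W N s) by exact: continuous_fmul.
have -> : cmean (fun s => c^-1 * h s * (1 + cos (t - s)) ^+ N) =
          c^-1 * cmean (fun s => h s * W N s).
  by rewrite -cmeanZ//; congr cmean; apply/funext => s; rewrite mulrA.
have bnd (a b : R) : cmean (fun s =>
  a * W N s + b * W N.+1 s) = (a + b * (2 - N.+1%:R^-1)) * c.
  rewrite cmeanD; [|exact: continuous_cmul|exact: continuous_cmul].
  by rewrite !cmeanZ// mW mS; ring.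
have cb (a b : R) : continuous (fun s => a * W N s + b * W N.+1 s).
  by move=> s; apply: cvgD; [exact: (continuous_cmul (cW N))|exact:
    (continuous_cmul (cW N.+1))].
have W0 s : 0 <= W N s by rewrite exprn_ge0//; have := cos_geN1 (t - s); lra.
have WS s : W N.+1 s = W N s * (1 + cos (t - s)) by rewrite /W exprSr.
have cV : 0 < c^-1 by rewrite invr_gt0.
have ci : c^-1 * c = 1 by rewrite mulVf// gt_eqF.
set I := cmean (fun s => h s * W N s).
clear mS; move: (N.+1%:R^-1 : R) hN bnd => V hN bnd.
have up : I <= (h t + e) * c.
  apply: (@le_trans _ _ ((h t + e / 2 + 2 * C + - C * (2 - V)) * c));
    last first.
    rewrite ler_pM2r// -subr_ge0.
    have -> : h t + e - (h t + e / 2 + 2 * C + - C * (2 - V)) = e / 2 - C * V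
      by field.
    by rewrite subr_ge0.
  rewrite -bnd; apply: le_cmean => // s sI; rewrite WS.
  have := hC s t sI tpi; rewrite ler_norml => /andP[_ hs].
  rewrite -subr_ge0.
  have -> : (h t + e / 2 + 2 * C) * W N s + - C * (W N s * (1 + cos (t - s))) -
    h s * W N s
     = W N s * ((e / 2 + C * (1 - cos (t - s))) - (h s - h t)) by ring.
  by rewrite mulr_ge0// subr_ge0.
have lo : (h t - e) * c <= I.
  apply: (@le_trans _ _ ((h t - e / 2 - 2 * C + C * (2 - V)) * c)).
    rewrite ler_pM2r// -subr_ge0.
    have -> : h t - e / 2 - 2 * C + C * (2 - V) - (h t - e) = e / 2 - C * V by
      field.
    by rewrite subr_ge0.
  rewrite -bnd; apply: le_cmean => // s sI; rewrite WS.
  have := hC s t sI tpi; rewrite ler_norml => /andP[hs _].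
  rewrite -subr_ge0.
  have -> : h s * W N s - ((h t - e / 2 - 2 * C) * W N s + C * (W N s * (1 +
    cos (t - s))))
     = W N s * ((h s - h t) - - (e / 2 + C * (1 - cos (t - s)))) by ring.
  by rewrite mulr_ge0// subr_ge0.
rewrite ler_distl; apply/andP; split.
  by rewrite mulrC ler_pdivlMr.
by rewrite mulrC ler_pdivrMr.
Qed.

(** The range covers both the integration interval of [cmean] and the arguments returned by
    [polar]. *)
Lemma trig_approx h (e : R) : continuous h -> periodic h (2 * pi) -> 0 < e ->
  exists p, forall t, - pi <= t <= 2 * pi -> `|Re p.[cis t] - h t| <= e.
Proof.
move=> ch ph e0; have [p hp] := trig_approx_period ch ph e0.
exists p => t /andP[t0 t2].
have [tpi|tpi] := leP t pi; first by apply: hp; rewrite t0.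
have cs : cis (t - 2 * pi) = cis t.
  have E : t = (t - 2 * pi) + pi *+ 2 by rewrite -[pi *+ 2]mulr_natl subrK.
  by rewrite [in RHS]E /cis cosD2pi sinD2pi.
have hs : h (t - 2 * pi) = h t by rewrite -[in RHS](subrK (2 * pi) t) ph.
have pi0 := pi_gt0 R.
by rewrite -cs -hs; apply: hp; apply/andP; split; move: t2 tpi pi0; clear; lra.
Qed.

Lemma cmean_approx h p (e : R) : continuous h ->
  (forall t, - pi <= t <= 2 * pi -> `|Re p.[cis t] - h t| <= e) ->
  `|Re p.[0] - cmean h| <= e.
Proof.
move=> ch hp.
have cp : continuous (fun t => Re p.[cis t]).
  by have := (continuous_horner_cis 1 p).1; under eq_fun do rewrite mul1r.
have ce : continuous (fun _ : R => e) by move=> t; exact: cvg_cst.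
have H t : 0 <= t <= 2 * pi -> - e <= Re p.[cis t] - h t <= e.
  move=> /andP[t0 t2]; rewrite -ler_norml; apply: hp.
  by rewrite t2 andbT (le_trans _ t0)// oppr_le0 pi_ge0.
have <- : cmean (fun t => Re p.[cis t]) = Re p.[0].
  by rewrite -(cmean_poly p 1); congr cmean; apply/funext => t; rewrite mul1r.
rewrite ler_distl; apply/andP; split.
  rewrite -(cmean_cst e) -cmeanB//; apply: le_cmean => //.
    by move=> t; exact: (cvgB (ch t) (ce t)).
  by move=> t /H/andP[h1 _]; rewrite lerBlDr -lerBlDl; move: h1; lra.
rewrite -(cmean_cst e) -cmeanD//; apply: le_cmean => //.
  by move=> t; exact: (cvgD (ch t) (ce t)).
by move=> t /H/andP[_ h1]; rewrite -lerBlDl.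
Qed.

End TrigApprox.

(** * Euclidean geometry *)

Section Euclid.
Variables (R : realType) (n : nat).
Implicit Types (x y z w b : Cn R n) (A : set (Cn R n)) (l : R[i]).
Local Notation Re := (@complex.Re R).
Local Notation Im := (@complex.Im R).
Local Notation normc := (@Normc.normc R).

(** Real part of the Hermitian product: the Euclidean inner product of the underlying real space. *)
Definition rdot z w : R :=
  \sum_i (Re (z 0 i) * Re (w 0 i) + Im (z 0 i) * Im (w 0 i)).

Lemma rdotC z w : rdot z w = rdot w z.
Proof. by apply: eq_bigr => i _; ring. Qed.

Lemma rdotDl z y w : rdot (z + y) w = rdot z w + rdot y w.
Proof.
rewrite -big_split; apply: eq_bigr => i _; rewrite mxE !complexE.
by rewrite /=; ring.
Qed.

Lemma rdotDr z y w : rdot w (z + y) = rdot w z + rdot w y.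
Proof. by rewrite rdotC rdotDl !(rdotC w). Qed.

Lemma rdotZl (s : R) z w : rdot ((s%:C)%C *: z) w = s * rdot z w.
Proof.
by rewrite mulr_sumr; apply: eq_bigr => i _; rewrite mxE !complexE /=; ring.
Qed.

Lemma rdotZr (s : R) z w : rdot w ((s%:C)%C *: z) = s * rdot w z.
Proof. by rewrite rdotC rdotZl rdotC. Qed.

Lemma rdotNl z w : rdot (- z) w = - rdot z w.
Proof.
by rewrite /rdot -sumrN; apply: eq_bigr => i _; rewrite mxE !complexE; ring.
Qed.

Lemma rdotNr z w : rdot w (- z) = - rdot w z.
Proof. by rewrite rdotC rdotNl rdotC. Qed.

Lemma rdot_ge0 z : 0 <= rdot z z.
Proof. by apply: sumr_ge0 => i _; rewrite addr_ge0// -expr2 sqr_ge0. Qed.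

Lemma enormE z : enorm z = Num.sqrt (rdot z z).
Proof. by []. Qed.

Lemma enorm_ge0 z : 0 <= enorm z. Proof. exact: sqrtr_ge0. Qed.

Lemma enorm_sq z : enorm z ^+ 2 = rdot z z.
Proof. by rewrite sqr_sqrtr// rdot_ge0. Qed.

(** Cauchy-Schwarz from positivity of |B z - P w|^2 and |A w - P z|^2. If A = B = 0, positivity of
    |z + w|^2 and |z - w|^2 forces P = 0. *)
Lemma rdot_sq z w : rdot z w ^+ 2 <= rdot z z * rdot w w.
Proof.
set P := rdot z w; set A := rdot z z; set B := rdot w w.
have A0 : 0 <= A := rdot_ge0 z; have B0 : 0 <= B := rdot_ge0 w.
have h1 : 0 <= B * (A * B - P ^+ 2).
  have := rdot_ge0 ((B%:C)%C *: z - (P%:C)%C *: w).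
  rewrite rdotDl rdotNl !rdotDr !rdotNr !rdotZl !rdotZr (rdotC w z) -/P -/A -/B.
  by rewrite [X in 0 <= X -> _](_ : _ = B * (A * B - P ^+ 2))//; ring.
have h2 : 0 <= A * (A * B - P ^+ 2).
  have := rdot_ge0 ((A%:C)%C *: w - (P%:C)%C *: z).
  rewrite rdotDl rdotNl !rdotDr !rdotNr !rdotZl !rdotZr (rdotC w z) -/P -/A -/B.
  by rewrite [X in 0 <= X -> _](_ : _ = A * (A * B - P ^+ 2))//; ring.
have [Bp|] := ltP 0 B; first by move: h1; rewrite pmulr_rge0// subr_ge0.
have [Ap|] := ltP 0 A; first by move: h2; rewrite pmulr_rge0// subr_ge0.
move=> Al Bl.
have AE : A = 0 by apply/le_anti; rewrite Al.
have BE : B = 0 by apply/le_anti; rewrite Bl.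
have h3 : 0 <= 2 * P.
  have := rdot_ge0 (z + w); rewrite rdotDl !rdotDr (rdotC w z) -/P -/A -/B; lra.
have h4 : 0 <= - (2 * P).
  have := rdot_ge0 (z - w); rewrite rdotDl rdotNl !rdotDr !rdotNr (rdotC w z)
    -/P -/A -/B; lra.
have -> : P = 0 by lra.
by rewrite AE BE mulr0 expr0n.
Qed.

Lemma enormD z w : enorm (z + w) <= enorm z + enorm w.
Proof.
rewrite -(@ler_pXn2r _ 2)// ?nnegrE ?addr_ge0 ?enorm_ge0//.
rewrite sqrrD !enorm_sq rdotDl !rdotDr (rdotC w z).
suff : rdot z w <= enorm z * enorm w by rewrite -mulr_natr; lra.
apply: le_trans (ler_norm _) _.
rewrite -(@ler_pXn2r _ 2)// ?nnegrE ?mulr_ge0 ?enorm_ge0//.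
by rewrite real_normK ?num_real// exprMn !enorm_sq rdot_sq.
Qed.

Lemma enormN z : enorm (- z) = enorm z.
Proof. by rewrite !enormE rdotNl rdotNr opprK. Qed.

Lemma enormB z w : enorm (z - w) = enorm (w - z).
Proof. by rewrite -enormN opprB. Qed.

Lemma enorm0 : enorm (0 : Cn R n) = 0.
Proof. by rewrite enormE -{1}(subrr 0) rdotDl rdotNl subrr sqrtr0. Qed.

Lemma ler_enormB x y z : enorm (x - z) <= enorm (x - y) + enorm (y - z).
Proof. by rewrite (le_trans _ (enormD _ _))// addrA subrK. Qed.

Lemma normc_sq l : normc l ^+ 2 = Re l ^+ 2 + Im l ^+ 2.
Proof. by case: l => a b /=; rewrite sqr_sqrtr// addr_ge0 ?sqr_ge0. Qed.

Lemma normc_ge0 l : 0 <= normc l.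
Proof. by case: l => a b /=; exact: sqrtr_ge0. Qed.

Lemma enormZ l z : enorm (l *: z) = normc l * enorm z.
Proof.
apply: (@pexpIrn _ 2) => //; rewrite ?nnegrE ?mulr_ge0 ?enorm_ge0 ?normc_ge0//.
rewrite exprMn !enorm_sq normc_sq mulr_sumr; apply: eq_bigr => i _.
by rewrite mxE !complexE; ring.
Qed.

Lemma normc_le l : normc l <= `|Re l| + `|Im l|.
Proof.
rewrite -(@ler_pXn2r _ 2)// ?nnegrE ?addr_ge0 ?normc_ge0//.
rewrite normc_sq sqrrD !real_normK ?num_real//.
by rewrite -addrA lerD2l lerDr mulrn_wge0// mulr_ge0.
Qed.

Lemma normc_real (s : R) : normc (s%:C)%C = `|s|.
Proof. by rewrite /= expr0n addr0 sqrtr_sqr. Qed.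

Lemma normc_cis (r t : R) : normc ((r%:C)%C * cis t) = `|r|.
Proof.
rewrite Normc.normcM normc_real -[RHS]mulr1; congr (_ * _).
by rewrite /= cos2Dsin2 sqrtr1.
Qed.

Lemma normCE l : `|l| = (normc l)%:C%C.
Proof. by case: l. Qed.

Lemma entry_le z i : normc (z 0 i) <= enorm z.
Proof.
rewrite -(@ler_pXn2r _ 2)// ?nnegrE ?enorm_ge0 ?normc_ge0//.
rewrite normc_sq enorm_sq /rdot (bigD1 i)//= !expr2 lerDl.
by apply: sumr_ge0 => j _; rewrite addr_ge0// -expr2 sqr_ge0.
Qed.

(** Entries are bounded by [enorm]; conversely, entries below r / (n + 1) give a squared norm below
    r^2. Radii of library balls are positive elements of [R[i]], hence real. *)
Lemma nbhs_enormP z A :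
  nbhs z A <-> exists2 r : R, 0 < r & forall y, enorm (y - z) < r -> A y.
Proof.
split=> [/nbhs_ballP[e /= e0 hA]|[r r0 hA]].
  have eE : e = (Re e)%:C%C.
    by move: e0; rewrite ltcE /= => /andP[/eqP]; case: (e) => a b /= ->.
  have e1 : 0 < Re e by move: e0; rewrite ltcE => /andP[].
  exists (Re e) => // y yz; apply: hA; split=> // i j.
  rewrite !ord1 eE -ball_normE /= normCE ltcR.
  apply: le_lt_trans yz; rewrite enormB.
  by have := entry_le (z - y) j; rewrite !mxE.
apply/nbhs_ballP; exists ((r / n.+1%:R)%:C)%C => /=.
  by rewrite ltcR divr_gt0.
move=> y [_ yz]; apply: hA.
have n1 : 1 <= n.+1%:R :> R by rewrite ler1n.
have n0 : 0 < n.+1%:R :> R by rewrite ltr0n.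
rewrite -(@ltr_pXn2r _ 2)// ?nnegrE ?enorm_ge0 ?(ltW r0)//.
rewrite enorm_sq /rdot.
apply: (@lt_le_trans _ _ (\sum_(i < n.+1) (r / n.+1%:R) ^+ 2)).
  apply: ltr_sum; first by apply/hasP; exists ord0; rewrite ?mem_index_enum.
  move=> i _; have := yz 0 i; rewrite -ball_normE /= normCE ltcR => yzi.
  rewrite -!expr2 -normc_sq ltr_pXn2r// ?nnegrE ?normc_ge0 ?divr_ge0 ?(ltW
    r0)//.
  apply: le_lt_trans yzi; rewrite !mxE.
  by case: (y 0 i) => a b; case: (z 0 i) => c d /=;
    rewrite le_eqVlt -sqrrN opprB -[(d - b) ^+ 2]sqrrN opprB eqxx.
rewrite sumr_const card_ord -[_ *+ n.+1]mulr_natr expr_div_n.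
rewrite -mulrA ler_piMr ?sqr_ge0// expr2 invfM -mulrA mulVf ?gt_eqF//.
by rewrite mulr1 invf_le1.
Qed.

Lemma nbhs_eball z (r : R) : 0 < r -> nbhs z (eball z r).
Proof. by move=> r0; apply/nbhs_enormP; exists r. Qed.

Lemma cvg_enormP (T : Type) (F : set_system T) {FF : Filter F} (g : T ->
  Cn R n) z :
  (forall e : R, 0 < e -> \forall t \near F,
    enorm (g t - z) < e) <-> g @ F --> z.
Proof.
split=> [H A /nbhs_enormP[r r0 hA]|H e e0].
  by apply: filterS (H r r0) => t; exact: hA.
by have := H _ (nbhs_eball z e0).
Qed.

Lemma enorm_lip x y : `|enorm x - enorm y| <= enorm (x - y).
Proof.
rewrite ler_norml; apply/andP; split.
  have := enormD (y - x) x; rewrite subrK enormB; lra.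
have := enormD (x - y) y; rewrite subrK; lra.
Qed.

Lemma real_cvgP (T : Type) (F : set_system T) {FF : Filter F} (u : T ->
  R) (l : R) :
  u @ F --> l <-> (forall e : R, 0 < e -> \forall t \near F, `|u t - l| < e).
Proof.
split=> [/cvgrPdist_lt H e e0|H].
  by have := H _ e0; apply: filterS => t; rewrite distrC.
by apply/cvgrPdist_lt => e e0; have := H _ e0; apply: filterS => t;
  rewrite distrC.
Qed.

Lemma enorm_lip_cvg (u : Cn R n -> R) z (C : R) :
  (\forall y \near z, `|u y - u z| <= C * enorm (y - z)) ->
    u y @[y --> z] --> u z.
Proof.
move=> H; apply: (@real_cvgP _ (nbhs z) (nbhs_filter z) _ _).2 => e e0.
have C1 : 0 < `|C| + 1 by rewrite ltr_wpDl.
have H2 := nbhs_eball z (divr_gt0 e0 C1).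
apply: filterS2 H H2 => y Hy yz.
apply: le_lt_trans Hy _.
apply: (@le_lt_trans _ _ ((`|C| + 1) * enorm (y - z))).
  apply: ler_wpM2r; first exact: enorm_ge0.
  by rewrite (le_trans (ler_norm _))// lerDl.
by rewrite mulrC -ltr_pdivlMr.
Qed.

Lemma cvg_scale (T : Type) (F : set_system T) {FF : Filter F} (f : T ->
  R[i]) l b :
  Re (f t) @[t --> F] --> Re l -> Im (f t) @[t --> F] --> Im l ->
  (f t *: b : Cn R n) @[t --> F] --> (l *: b : Cn R n).
Proof.
move=> /cvgrPdist_lt cr /cvgrPdist_lt ci; apply/cvg_enormP => e e0.
have B0 : 0 < 2 * (enorm b + 1) by rewrite mulr_gt0// ltr_wpDl ?enorm_ge0.
have e1 := divr_gt0 e0 B0.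
near=> t.
rewrite -scalerBl enormZ.
have h : normc (f t - l) < e / (enorm b + 1).
  apply: le_lt_trans (normc_le _) _; rewrite !complexE.
  apply: (@lt_le_trans _ _ (e / (2 * (enorm b + 1)) + e / (2 * (enorm b + 1)))).
    by apply: ltrD; rewrite distrC; near: t; [exact: cr|exact: ci].
  rewrite le_eqVlt; apply/orP; left; apply/eqP; field.
  by rewrite gt_eqF// ltr_wpDl ?enorm_ge0.
apply: (@le_lt_trans _ _ (normc (f t - l) * (enorm b + 1))).
  by rewrite ler_wpM2l ?normc_ge0// lerDl.
by rewrite -ltr_pdivlMr// ltr_wpDl ?enorm_ge0.
Unshelve. all: by end_near. Qed.

End Euclid.

(** * Compactness and the distance to the boundary *)

Section Domain.
Variables (R : realType) (n : nat).
Implicit Types (x y z w b v : Cn R n) (A F Omega : set (Cn R n)) (l : R[i]).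
Local Notation Re := (@complex.Re R).
Local Notation Im := (@complex.Im R).
Local Notation normc := (@Normc.normc R).
Local Notation edist := (@Defs.edist R n).

Lemma compact_square (M : R) :
  compact [set l : Cplx R | `|Re l| <= M /\ `|Im l| <= M].
Proof.
have cI : compact (`[- M, M]%classic : set R) by exact: segment_compact.
have := compact_setX cI cI.
set K := _ `*` _ => cK.
pose g (p : R * R) : Cplx R := (p.1 +i* p.2)%C.
suff cg : {within K, continuous g}.
  have := continuous_compact cg cK; congr compact.
  apply/seteqP; split=> [_ [[a b] [/= a1 b1] <-]|[a b] /= [a1 b1]] /=.
    by rewrite /= in_itv/= in a1; rewrite in_itv/= in b1; rewrite !ler_norml.
  by exists (a, b) => //; split; rewrite /= in_itv/= -ler_norml.
apply: continuous_subspaceT => p; apply/cvgrPdist_lt => e e0.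
have eE : e = (Re e)%:C%C.
  by move: e0; rewrite ltcE /= => /andP[/eqP]; case: (e) => a b /= ->.
have e1 : 0 < Re e by move: e0; rewrite ltcE => /andP[].
have e2 : 0 < Re e / 2 by rewrite divr_gt0.
have /cvgrPdist_lt/(_ _ e2) c1 : q.1 @[q --> p] --> p.1 by exact: cvg_fst.
have /cvgrPdist_lt/(_ _ e2) c2 : q.2 @[q --> p] --> p.2 by exact: cvg_snd.
near=> q.
rewrite normCE eE ltcR (le_lt_trans (normc_le _))//= [Re e]splitr.
by apply: ltrD; near: q.
Unshelve. all: by end_near. Qed.

Lemma closed_ebounded_compact A : closed A -> ebounded A -> compact A.
Proof.
move=> cA [M AM].
apply: (@subclosed_compact _ A
  [set z : Cn R n | forall i,
    [set l : Cplx R | `|Re l| <= M /\ `|Im l| <= M] (z 0 i)]) => //.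
  apply: (@rV_compact (Cplx R) _ (fun _ =>
    [set l : Cplx R | `|Re l| <= M /\ `|Im l| <= M])).
  by move=> i; exact: compact_square.
move=> z /AM; rewrite /eball /= subr0 => zM i.
have h := le_lt_trans (entry_le z i) zM.
have M0 : 0 <= M by apply: ltW; apply: le_lt_trans zM; exact: enorm_ge0.
split; apply/ltW; apply: le_lt_trans h;
  rewrite -(@ler_pXn2r _ 2)// ?nnegrE ?normc_ge0// normc_sq real_normK
  ?num_real//.
  by rewrite lerDl sqr_ge0.
by rewrite lerDr sqr_ge0.
Qed.

Lemma has_lbound_dist z F : has_lbound [set enorm (z - x) | x in F].
Proof. by exists 0 => _ [x _ <-]; exact: enorm_ge0. Qed.

Lemma edist_le z F x : F x -> edist z F <= enorm (z - x).
Proof. by move=> Fx; apply: ge_inf; [exact: has_lbound_dist|exists x]. Qed.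

Lemma edist_ge z F (r : R) : F !=set0 -> (forall x, F x ->
  r <= enorm (z - x)) ->
  r <= edist z F.
Proof.
move=> [x Fx] H; apply: lb_le_inf; first by exists (enorm (z - x)), x.
by move=> _ [y Fy <-]; exact: H.
Qed.

Lemma edist_lt z F (r : R) : F !=set0 -> edist z F < r ->
  exists2 x, F x & enorm (z - x) < r.
Proof.
move=> F0 zr; apply: contrapT => H; move: zr; rewrite ltNge => /negP; apply.
apply: edist_ge => // x Fx; rewrite leNgt; apply/negP => xr; apply: H.
by exists x.
Qed.

Lemma edist_ge0 z F : 0 <= edist z F.
Proof.
have [F0|/nonemptyPn ->] := pselect (F !=set0); last first.
  by rewrite /edist image_set0 inf0.
by apply: edist_ge => // x _; exact: enorm_ge0.
Qed.

Lemma edist_lip F y z : F !=set0 -> `|edist y F - edist z F| <= enorm (y - z).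
Proof.
move=> F0.
have H u v : edist u F - edist v F <= enorm (u - v).
  rewrite lerBlDr addrC -lerBlDr; apply: edist_ge => // x Fx.
  rewrite lerBlDr addrC; apply: le_trans (edist_le u Fx) _.
  exact: ler_enormB.
by rewrite ler_norml H andbT lerNl opprB enormB H.
Qed.

Lemma open_boundaryE Omega : open Omega ->
  boundary Omega = closure Omega `\` Omega.
Proof. by move=> /interior_id oO; rewrite /boundary oO. Qed.

Lemma closed_boundary Omega : closed (boundary Omega).
Proof.
rewrite /boundary setDE; apply: closedI; first exact: closed_closure.
by apply: open_closedC; exact: open_interior.
Qed.

(** The parameters whose point lies in [Omega] form a nonempty subset of [0, 1] that is open, and
    also closed because the segment misses the boundary. *)
Lemma open_segment Omega z v : open Omega -> Omega z ->
  (forall t : R, 0 <= t <= 1 -> ~ boundary Omega (z + (t%:C)%C *: v)) ->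
    Omega (z + v).
Proof.
move=> oO Oz H.
pose g (t : R) : Cn R n := z + (t%:C)%C *: v.
have cg : continuous g.
  move=> t; apply: cvgD; first exact: cvg_cst.
  by apply: cvg_scale; [exact: cvg_id|exact: cvg_cst].
have cI : connected (`[0, 1]%classic : set R) by exact: segment_connected.
have := cI (`[0, 1]%classic `&` g @^-1` Omega).
have g0 : g 0 = z by rewrite /g scale0r addr0.
have g1 : g 1 = z + v by rewrite /g scale1r.
move=> /(_ _ _ _) E; suff : (`[0, 1]%classic `&` g @^-1` Omega) 1 by case=> _;
  rewrite /= g1.
rewrite E; first by rewrite /= in_itv/= ler01 lexx.
- by exists 0; split; rewrite /= ?in_itv/= ?lexx ?ler01// g0.
- by exists (g @^-1` Omega) => //; apply: open_comp => // t _; exact: cg.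
- exists (g @^-1` closure Omega).
    by apply: closed_comp => [t _|]; [exact: cg|exact: closed_closure].
  apply/seteqP; split=> t [tI gt]; split=> //; first exact: subset_closure.
  apply: contrapT => nO; apply: (H t); first by rewrite /= in_itv/= in tI.
  by rewrite open_boundaryE.
Qed.

Lemma bdist_ball Omega z y : open Omega -> Omega z ->
  enorm (y - z) < bdist Omega z -> Omega y.
Proof.
move=> oO Oz yz; rewrite -[y](subrKC z);
  apply: open_segment => // t /andP[t0 t1] bt.
have := edist_le z bt; apply/negP; rewrite -ltNge; apply: le_lt_trans yz.
rewrite enormB [_ + (t%:C)%C *: _]addrC addrK enormZ normc_real ger0_norm//.
by rewrite ler_piMl ?enorm_ge0.
Qed.

Lemma boundary_nonempty Omega z : open Omega -> ebounded Omega -> Omega z ->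
  boundary Omega !=set0.
Proof.
move=> oO [M OM] Oz.
apply: contrapT => /nonemptyPn b0.
(* A translation this long in the first coordinate direction leaves the ball of radius M; a segment
   that never met the boundary could not do so. *)
pose s : R := enorm z + `|M|.
have := @open_segment Omega z ((s%:C)%C *: delta_mx 0 0) oO Oz.
rewrite b0 => /(_ (fun _ _ => id)) /OM.
rewrite /eball /= subr0; apply/negP; rewrite -leNgt.
have := enormD (z + (s%:C)%C *: delta_mx 0 0) (- z).
rewrite [z + _]addrC addrK enormN enormZ normc_real.
have -> : enorm (delta_mx 0 0 : Cn R n) = 1.
  rewrite enormE /rdot (bigD1 ord0)//= big1 ?addr0 => [|i i0].
    by rewrite mxE !eqxx /= mul1r mul0r addr0 sqrtr1.
  by rewrite mxE (negbTE i0) andbF /= !mul0r addr0.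
rewrite mulr1 ger0_norm ?addr_ge0 ?enorm_ge0// [_ *: _ + z]addrC /s.
have := ler_norm M; lra.
Qed.

Lemma bdist_ge Omega z (r : R) : open Omega -> boundary Omega !=set0 ->
  (forall y, enorm (y - z) < r -> Omega y) -> r <= bdist Omega z.
Proof.
move=> oO b0 H; apply: edist_ge => // x.
rewrite open_boundaryE// => -[_ nx]; rewrite leNgt; apply/negP => xr.
by apply/nx/H; rewrite enormB.
Qed.

Lemma bdist_gt0 Omega z : open Omega -> boundary Omega !=set0 -> Omega z ->
  0 < bdist Omega z.
Proof.
move=> oO b0 Oz.
have /nbhs_enormP[r r0 hr] : nbhs z Omega by exact: open_nbhs_nbhs.
by apply: lt_le_trans r0 _; exact: bdist_ge.
Qed.

Lemma bdist_boundary Omega z : boundary Omega z -> bdist Omega z = 0.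
Proof.
move=> bz; apply/le_anti; rewrite edist_ge0 andbT.
by have := edist_le z bz; rewrite subrr enorm0.
Qed.

Lemma bdist_continuous Omega : boundary Omega !=set0 ->
  continuous (bdist Omega).
Proof.
move=> b0 z; apply: (@enorm_lip_cvg _ _ _ _ 1); near=> y.
by rewrite mul1r; exact: edist_lip.
Unshelve. all: by end_near. Qed.

Lemma boundary_compact Omega : ebounded Omega -> compact (boundary Omega).
Proof.
move=> [M OM]; apply: closed_ebounded_compact; first exact: closed_boundary.
exists (M + 1) => z [cz _].
have [y [Oy yz]] : Omega `&` eball z 1 !=set0 by apply: cz; exact: nbhs_eball.
have := OM _ Oy; rewrite /eball /= !subr0 in yz * => yM.
have := ler_enormB z y 0; rewrite !subr0 enormB => h.
by apply: le_lt_trans h _; rewrite addrC ltrD.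
Qed.

End Domain.

(** * The maximum principle on polynomial discs *)

Arguments Normc.normc : simpl never.

Section MaxPrinciple.
Variables (R : realType) (n : nat).
Implicit Types (x y z w b c : Cn R n) (Omega : set (Cn R n)) (l : R[i]) (q :
  {poly R[i]}).
Local Notation Re := (@complex.Re R).
Local Notation Im := (@complex.Im R).
Local Notation normc := (@Normc.normc R).

Definition ccirc (r t : R) : R[i] := (r%:C)%C * cis t.

(** For continuous [u] this follows from [psh] by [psh_submean], and its local form gives [psh] back
    by [local_submean_psh]; in between, all means are real numbers. *)
Definition submean_on Omega (u : Cn R n -> R) : Prop :=
  forall z b (r : R), 0 < r -> (forall l, normc l <= r -> Omega (z + l *: b)) ->
    u z <= cmean (fun t => u (z + ccirc r t *: b)).

Lemma normc_ccirc (r t : R) : normc (ccirc r t) = `|r|.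
Proof. exact: normc_cis. Qed.

Lemma ccirc_continuous (r : R) b z : continuous (fun t =>
  z + ccirc r t *: b : Cn R n).
Proof.
move=> t; apply: cvgD; first exact: cvg_cst.
apply: cvg_scale.
  under eq_fun do rewrite Re_mul /= mul0r subr0; rewrite Re_mul /= mul0r subr0.
  by apply: cvgM; [exact: cvg_cst|exact: continuous_cos].
under eq_fun do rewrite Im_mul /= mul0r addr0; rewrite Im_mul /= mul0r addr0.
by apply: cvgM; [exact: cvg_cst|exact: continuous_sin].
Qed.

Lemma continuous_on_circle Omega (u : Cn R n -> R) z b (r : R) :
  (forall z, Omega z -> u y @[y --> z] --> u z) -> 0 <= r ->
  (forall l, normc l <= r -> Omega (z + l *: b)) ->
  continuous (fun t => u (z + ccirc r t *: b)).
Proof.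
move=> cu r0 H t; apply: (@continuous_comp _ _ _ (fun t =>
  z + ccirc r t *: b : Cn R n) u).
  exact: ccirc_continuous.
by apply: cu; apply: H; rewrite normc_ccirc ger0_norm.
Qed.

Lemma psh_submean Omega (u : Cn R n -> R) :
  (forall z, Omega z -> u y @[y --> z] --> u z) ->
  psh Omega (EFin \o u) -> submean_on Omega u.
Proof.
move=> cu [_ _ H] z b r r0 D.
have [_ _ /(_ 0 r r0)] := H z b.
have D' (l : Cplx R) : `|l - 0| <= (r%:C)%C -> Omega (z + l *: b).
  by rewrite subr0 normCE lecR; exact: D.
move=> /(_ D'); rewrite /= scale0r addr0.
have -> : (fun t => (u (z + circle 0 r t *: b))%:E) = (fun t =>
  (u (z + ccirc r t *: b))%:E).
  by apply/funext => t; rewrite /circle add0r.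
by rewrite cmeanE ?lee_fin//; exact: (continuous_on_circle cu (ltW r0) D).
Qed.

Lemma horner_bounded (p : {poly R[i]}) : exists2 B : R, 0 <= B & forall l,
  normc l <= 1 -> normc p.[l] <= B.
Proof.
elim/poly_ind: p => [|p c [B B0 hB]].
  by exists 0 => // l _; rewrite horner0 Normc.normc0.
exists (B + normc c) => [|l l1]; first by rewrite addr_ge0 ?normc_ge0.
rewrite hornerMXaddC (le_trans (le_normcD _ _))// lerD2r Normc.normcM.
by rewrite (le_trans (ler_wpM2l (normc_ge0 _) l1))// mulr1 hB.
Qed.

Lemma normcD_sq (l m : R[i]) :
  normc (l + m) ^+ 2 = normc l ^+ 2 + 2 * Re ((l^*)%C * m) + normc m ^+ 2.
Proof. by rewrite !normc_sq !complexE; case: l m => [? ?] [? ?] /=; ring. Qed.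

(** The disc is parametrized by pairs of reals, so that compactness and the extreme value theorem
    are applied in the plane [R * R]. *)
Definition cpair (p : R * R) : R[i] := (p.1 +i* p.2)%C.

Definition udisc : set (R * R) := [set p | normc (cpair p) <= 1].

Lemma udisc_compact : compact udisc.
Proof.
have cI : compact (`[- 1, 1]%classic : set R) by exact: segment_compact.
apply: (@subclosed_compact _ udisc _ _ (compact_setX cI cI)).
- have -> : udisc = (fun p : R * R =>
    p.1 ^+ 2 + p.2 ^+ 2) @^-1` [set x | x <= 1].
    apply/seteqP; split=> p; rewrite /udisc /= => h.
      by rewrite -(normc_sq (cpair p)) -(expr1n _ 2) ler_pXn2r// ?nnegrE
        ?normc_ge0.
    by rewrite -(@ler_pXn2r _ 2)// ?nnegrE ?normc_ge0// expr1n normc_sq.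
  apply: closed_comp => [p _|]; last exact: closed_le.
  by apply: cvgD; apply: cvgM;
    [exact: cvg_fst|exact: cvg_fst|exact: cvg_snd|exact: cvg_snd].
- move=> p; rewrite /udisc /= => h; rewrite !in_itv/= -!ler_norml.
  split; apply: le_trans h; rewrite -(@ler_pXn2r _ 2)// ?nnegrE ?normc_ge0//
    normc_sq real_normK ?num_real//=.
    by rewrite lerDl sqr_ge0.
  by rewrite lerDr sqr_ge0.
Qed.

Lemma cpair_continuous (T : Type) (F : set_system T) {FF : Filter F} (f : T ->
  R * R) a b :
  f @ F --> a -> (cpair (f t) *: b : Cn R n) @[t --> F] --> (cpair a *: b : Cn
    R n).
Proof.
move=> fa; apply: cvg_scale => /=.
  by apply: (cvg_comp f fst fa); exact: cvg_fst.
by apply: (cvg_comp f snd fa); exact: cvg_snd.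
Qed.

Lemma normc_cpair_sq_cvg (T : Type) (F : set_system T) {FF : Filter F}
    (f : T -> R * R) a :
  f @ F --> a -> normc (cpair (f t)) ^+ 2 @[t --> F] --> normc (cpair a) ^+ 2.
Proof.
move=> fa; under eq_fun do rewrite normc_sq; rewrite normc_sq /=.
have f1 : (f t).1 @[t --> F] --> a.1 by apply: (cvg_comp f fst fa);
  exact: cvg_fst.
have f2 : (f t).2 @[t --> F] --> a.2 by apply: (cvg_comp f snd fa);
  exact: cvg_snd.
by apply: cvgD; apply: cvgM.
Qed.

Lemma poly_disc_continuous z b c q (p0 : R * R) :
  (z + cpair p *: b + q.[cpair p] *: c : Cn R n) @[p --> p0]
  --> (z + cpair p0 *: b + q.[cpair p0] *: c : Cn R n).
Proof.
apply: cvgD; first by apply: cvgD; [exact: cvg_cst|apply: cpair_continuous;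
  exact: cvg_id].
have c1 : Re (cpair p) @[p --> p0] --> Re (cpair p0) by exact: cvg_fst.
have c2 : Im (cpair p) @[p --> p0] --> Im (cpair p0) by exact: cvg_snd.
by have [h1 h2] := horner_continuous q c1 c2; exact: cvg_scale.
Qed.

Lemma poly_taylor2 q (l0 : R[i]) : exists (c0 c1 : R[i]) (T : {poly R[i]}),
  q.[l0] = c0 /\
  forall m, q.[l0 + m] = c0 + c1 * m + m ^+ 2 * T.[m].
Proof.
pose q0 := q \Po ('X + l0%:P).
exists q0`_0, q0`_1, (drop_poly 2 q0).
have E m : q.[l0 + m] = q0.[m] by rewrite horner_comp !hornerE addrC.
have H m : q0.[m] = q0`_0 + q0`_1 * m + m ^+ 2 * (drop_poly 2 q0).[m].
  rewrite -{1}(poly_take_drop 2 q0) hornerD hornerM hornerXn [_ * m ^+ 2]mulrC.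
  congr (_ + _); rewrite /take_poly horner_poly.
  by rewrite !big_ord_recr big_ord0 /= add0r expr0 mulr1 expr1.
split=> [|m]; last by rewrite E H.
by rewrite -[l0 in LHS]addr0 E H !mulr0 addr0 expr0n /= mul0r addr0.
Qed.

Lemma normRe_le l : `|Re l| <= normc l.
Proof.
by rewrite -(@ler_pXn2r _ 2)// ?nnegrE ?normc_ge0// normc_sq real_normK
  ?num_real// lerDl sqr_ge0.
Qed.

Lemma normIm_le l : `|Im l| <= normc l.
Proof.
by rewrite -(@ler_pXn2r _ 2)// ?nnegrE ?normc_ge0// normc_sq real_normK
  ?num_real// lerDr sqr_ge0.
Qed.

Lemma normc_opp l : normc (- l) = normc l.
Proof. exact: normcN. Qed.

(* [u] is only known to be subharmonic on complex lines, and is not smooth.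
   Maximize [u (g l + h c) - A |h|^2 + k |l|^2] over (l, h).  At an interior
   maximum, replacing h by [h - E], with E the second order remainder of q,
   keeps the point on a complex line; E has mean 0, so this costs only
   [A |E|^2 = O(r^4)], against the gain [k r^2]. *)
Lemma disc_max_principle Omega (u : Cn R n -> R) z b c q (M : R) :
  open Omega -> (forall z, Omega z -> u y @[y --> z] --> u z) ->
  submean_on Omega u ->
  (forall l, normc l <= 1 -> Omega (z + l *: b + q.[l] *: c)) ->
  (forall l, normc l = 1 -> u (z + l *: b + q.[l] *: c) <= M) ->
  forall l, normc l <= 1 -> u (z + l *: b + q.[l] *: c) <= M.
Proof.
move=> oO cu su D M1 l1 l1n; rewrite leNgt; apply/negP => Ml1.
pose g l : Cn R n := z + l *: b + q.[l] *: c.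
rewrite -/(g l1) in Ml1.
(* A quarter of the assumed excess over M: passing from the disc to its tube costs k and the term k
   |l|^2 at most another k, so a maximum with |l| = 1 stays below M + 4 k. *)
pose k : R := (u (g l1) - M) / 4.
have k0 : 0 < k by rewrite divr_gt0// subr_gt0.
have kE : M + 4 * k = u (g l1) by rewrite /k; field.
clearbody k.
have k20 : 0 < k / 2 by rewrite divr_gt0.
have gcont p0 : (g (cpair p) : Cn R n) @[p --> p0] --> (g (cpair p0) : Cn R n).
  exact: poly_disc_continuous.
have c10 : 0 < enorm c + 1 by rewrite ltr_wpDl ?enorm_ge0.
(* Compactness of the disc gives one width for which the whole tube around it stays in [Omega] and
   [u] rises by at most k. *)
have [eta eta0 tube] : exists2 eta : R, 0 < eta &
    forall l h, normc l <= 1 -> normc h <= eta ->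
      Omega (g l + h *: c) /\ u (g l + h *: c) <= u (g l) + k.
  have /compact_near_coveringP := udisc_compact.
  move=> /(_ R (0 : R)^'+ (fun d p => forall h, normc h <= d ->
      Omega (g (cpair p) + h *: c) /\ u (g (cpair p) + h *: c) <= u (g (cpair
        p)) + k)).
  case=> [x xD|].
    have Ox : Omega (g (cpair x)) by exact: D.
    have n1 : nbhs (g (cpair x)) Omega by exact: open_nbhs_nbhs.
    have n2 := (@real_cvgP _ _ _ (nbhs_filter _) _ _).1 (cu _ Ox) _ k20.
    have n3 : nbhs (g (cpair x)) (Omega `&` [set t | `|u t - u (g (cpair x))| <
      k / 2]).
      by apply: filterI; [exact: n1|exact: n2].
    have [r r0 hr] := (nbhs_enormP _ _).1 n3.
    have r20 : 0 < r / 2 by rewrite divr_gt0.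
    exists ([set p | enorm (g (cpair p) - g (cpair x)) < r / 2],
            [set d | d * (enorm c + 1) < r / 2]).
      split; first exact: ((@cvg_enormP _ _ _ _ (nbhs_filter _) _ _).2 (gcont
        x) _ r20).
      rewrite /=; under eq_fun do rewrite -ltr_pdivlMr//.
      by apply: nbhs_right_lt; rewrite divr_gt0.
    move=> [p d] /= [gp dr] h hd.
    have [_ h1] : (Omega `&` [set t | `|u t - u (g (cpair x))| < k / 2]) (g
      (cpair p)).
      by apply: hr; apply: lt_trans gp _; rewrite ltr_pdivrMr// ltr_pMr// ltr1n.
    have [Oh h2] : (Omega `&` [set t | `|u t - u (g (cpair x))| < k / 2]) (g
      (cpair p) + h *: c).
      apply: hr; rewrite addrAC (le_lt_trans (enormD _ _))// [r]splitr ltrD//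
        enormZ.
      apply: le_lt_trans dr; apply: (@le_trans _ _ (d * enorm c)).
        by rewrite ler_wpM2r ?enorm_ge0.
      rewrite ler_wpM2l ?lerDl//; apply: le_trans hd; exact: normc_ge0.
    split=> //; move: h1 h2; rewrite /= !ltr_norml => /andP[h1 _] /andP[_ h2];
      lra.
  move=> d /= d0 hd; exists (d / 2); first by rewrite divr_gt0.
  move=> l h ln hn.
  have := hd (d / 2); rewrite /= sub0r normrN gtr0_norm ?divr_gt0//.
  rewrite ltr_pdivrMr// ltr_pMr// ltr1n => /(_ isT isT (Re l, Im l)).
  by rewrite /udisc /cpair /=; case: l ln => la lb /= ln; apply.
have u0 : udisc !=set0 by exists (0, 0); rewrite /udisc /= Normc.normc0.
have uc : {within udisc, continuous (fun p => u (g (cpair p)))}.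
  apply: continuous_in_subspaceT => p /set_mem pD.
  by apply: (cvg_comp _ _ (gcont p)); apply: cu; exact: D.
have [pm _ hpm] := compact_EVT_max u0 udisc_compact uc.
pose B := u (g (cpair pm)) + k.
have hB l h : normc l <= 1 -> normc h <= eta -> u (g l + h *: c) <= B.
  move=> ln hn; have [_ h1] := tube l h ln hn; apply: (le_trans h1);
    rewrite lerD2r.
  by have := hpm (Re l, Im l); case: l ln {h1} => la lb ln; apply; rewrite inE.
pose e2 := eta / 2.
have e20 : 0 < e2 by rewrite divr_gt0.
(* The penalty A |h|^2 exceeds B - M once a coordinate of h reaches e2, so the maximum is interior
   in h. *)
pose A := (`|B - M| + 1) / e2 ^+ 2.
have A0 : 0 < A by rewrite divr_gt0 ?exprn_gt0// ltr_wpDl.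
have AB : B - M <= A * e2 ^+ 2.
  by rewrite /A divfK ?gt_eqF ?exprn_gt0//; have := ler_norm (B - M); lra.
pose I2 : set R := `[- e2, e2]%classic.
have cI2 : compact I2 by exact: segment_compact.
pose K := udisc `*` (I2 `*` I2).
have cK : compact K by apply: compact_setX;
  [exact: udisc_compact|exact: compact_setX].
pose Phi (p : (R * R) * (R * R)) := u (g (cpair p.1) + cpair p.2 *: c)
  - A * normc (cpair p.2) ^+ 2 + k * normc (cpair p.1) ^+ 2.
have hbox (h : R[i]) : `|Re h| <= e2 -> `|Im h| <= e2 -> normc h <= eta.
  by move=> h1 h2; rewrite (le_trans (normc_le _))// [eta]splitr lerD.
have Pcont : {within K, continuous Phi}.
  apply: continuous_in_subspaceT => p /set_mem [pD [/= p1 p2]].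
  rewrite /I2 /= in_itv/= -ler_norml in p1;
    rewrite /I2 /= in_itv/= -ler_norml in p2.
  have f1 : s.1 @[s --> p] --> p.1 by exact: cvg_fst.
  have f2 : s.2 @[s --> p] --> p.2 by exact: cvg_snd.
  apply: cvgD; last by apply: cvgM;
    [exact: cvg_cst|exact: (@normc_cpair_sq_cvg _ _ (nbhs_filter p) fst _ f1)].
  apply: cvgB; last by apply: cvgM;
    [exact: cvg_cst|exact: (@normc_cpair_sq_cvg _ _ (nbhs_filter p) snd _ f2)].
  apply: (@cvg_comp _ _ _ (fun s : (R * R) * (R * R) =>
    g (cpair s.1) + cpair s.2 *: c : Cn R n) u).
    apply: cvgD; first exact: (@cvg_comp _ _ _ fst (fun s =>
      g (cpair s) : Cn R n) _ _ _ f1 (gcont _)).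
    exact: (@cpair_continuous _ _ (nbhs_filter p) snd _ c f2).
  by apply: cu; have [] := tube (cpair p.1) (cpair p.2) pD (hbox (cpair p.2) p1
    p2).
have K0 : K !=set0.
  by exists ((0, 0), (0, 0)); split;
    rewrite /udisc /I2 /= ?Normc.normc0// !in_itv/= !oppr_le0 !ltW.
have [[p0 h0] /set_mem [/= p0D [h01 h02]] hmax] := compact_EVT_max K0 cK Pcont.
have {}hmax l h : normc l <= 1 -> `|Re h| <= e2 -> `|Im h| <= e2 ->
   u (g l + h *: c) - A * normc h ^+ 2 + k * normc l ^+ 2 <= Phi (p0, h0).
  move=> ln h1 h2; have := hmax ((Re l, Im l), (Re h, Im h)).
  rewrite /Phi /cpair /=; case: l h ln h1 h2 => la lb [ha hb] ln h1 h2; apply.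
  by rewrite inE; split => //=; rewrite /I2 /= !in_itv/= -!ler_norml.
have low : M + 4 * k <= Phi (p0, h0).
  have := hmax l1 0 l1n; rewrite scale0r addr0 Normc.normc0 /= normr0 =>
    /(_ (ltW e20) (ltW e20)).
  apply: le_trans; rewrite expr0n /= mulr0 subr0.
  by rewrite kE lerDl mulr_ge0 ?sqr_ge0// ltW.
rewrite /I2 /= in_itv/= -ler_norml in h01;
  rewrite /I2 /= in_itv/= -ler_norml in h02.
have {}p0D : normc (cpair p0) <= 1 by [].
rewrite /Phi /= in low hmax.
pose l0 := cpair p0; pose m0 := cpair h0; rewrite -/l0 -/m0 in p0D low hmax.
have R1 : Re m0 = h0.1 by []. have I1 : Im m0 = h0.2 by [].
rewrite -R1 in h01; rewrite -I1 in h02.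
have m0eta := hbox m0 h01 h02.
have kl0 : k * normc l0 ^+ 2 <= k.
  by apply: ler_piMr; [exact: ltW|rewrite exprn_ile1 ?normc_ge0].
have Am0 : 0 <= A * normc m0 ^+ 2 by rewrite mulr_ge0 ?sqr_ge0// ltW.
have l01 : normc l0 < 1.
  rewrite lt_neqAle p0D andbT; apply/eqP => l0E.
  have := M1 l0 l0E; rewrite -/(g l0) => h1.
  have [_ h2] := tube l0 m0 p0D m0eta; lra.
have far : A * e2 ^+ 2 <= A * normc m0 ^+ 2 -> False.
  by move=> h1; have h2 := hB l0 m0 p0D m0eta; lra.
have m01 : `|Re m0| < e2.
  rewrite lt_neqAle h01 andbT; apply/eqP => E; apply: far.
  rewrite ler_pM2l// normc_sq -E real_normK ?num_real// lerDl; exact: sqr_ge0.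
have m02 : `|Im m0| < e2.
  rewrite lt_neqAle h02 andbT; apply/eqP => E; apply: far.
  rewrite ler_pM2l// normc_sq -E real_normK ?num_real// lerDr; exact: sqr_ge0.
have [c0 [c1 [T [q0 qT]]]] := poly_taylor2 q l0.
have [C C0 hC] := horner_bounded T.
pose E (m : R[i]) := m ^+ 2 * T.[m].
pose P := g l0 + m0 *: c; pose b1 := b + c1 *: c.
have gE m : g (l0 + m) + (m0 - E m) *: c = P + m *: b1.
  by rewrite /P /b1 /g /E qT q0; apply/rowP => i; rewrite !mxE; ring.
pose s := Num.min (e2 - `|Re m0|) (e2 - `|Im m0|).
have s0 : 0 < s by rewrite lt_min !subr_gt0 m01.
(* [C * r <= s] keeps the corrected h in its square; [A * C ^+ 2 * r < k] makes the loss from E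
   smaller than the gain k r^2. *)
have [r [r0 r1 rl rC rA]] : exists r : R, [/\ 0 < r, r <= 1, normc l0 + r <= 1,
   C * r <= s & A * C ^+ 2 * r < k].
  have C1 : 0 < C + 1 by rewrite ltr_wpDl.
  have A1 : 0 <= A * C ^+ 2 by rewrite mulr_ge0 ?sqr_ge0// ltW.
  have A2 : 0 < A * C ^+ 2 + 1 by rewrite ltr_wpDl.
  pose r := Num.min (Num.min 1 (1 - normc l0)) (Num.min (s / (C + 1)) (k / (A *
    C ^+ 2 + 1))).
  have r0 : 0 < r by rewrite !lt_min ltr01 subr_gt0 l01 (divr_gt0 s0 C1)
    (divr_gt0 k0 A2).
  have h1 : r <= 1 by rewrite /r !ge_min lexx.
  have h2 : r <= 1 - normc l0 by rewrite /r !ge_min lexx !orbT.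
  have : r <= s / (C + 1) by rewrite /r !ge_min lexx !orbT.
  have : r <= k / (A * C ^+ 2 + 1) by rewrite /r !ge_min lexx !orbT.
  rewrite !ler_pdivlMr// !mulrDr !mulr1 => h3 h4.
  exists r; split => //; first by lra.
    by rewrite mulrC; lra.
  by rewrite mulrC; apply: lt_le_trans h3; rewrite ltrDl.
have r2r : r ^+ 2 <= r by rewrite expr2 ler_piMr// ltW.
have EC m : normc m <= r -> normc (E m) <= C * r ^+ 2.
  move=> mr; rewrite /E expr2 !Normc.normcM -expr2 mulrC.
  apply: ler_pM; rewrite ?normc_ge0 ?sqr_ge0//; first by apply: hC;
    exact: le_trans r1.
  by rewrite ler_pXn2r// ?nnegrE ?normc_ge0// ltW.
have ECs m : normc m <= r -> normc (E m) <= s.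
  move=> mr; apply: le_trans (EC m mr) _; apply: le_trans rC.
  by rewrite ler_wpM2l.
have inD m : normc m <= r ->
  [/\ normc (l0 + m) <= 1, `|Re (m0 - E m)| <= e2 & `|Im (m0 - E m)| <= e2].
  move=> mr; have := ECs m mr; rewrite /s le_min => /andP[h1 h2]; split.
  - by apply: le_trans (le_normcD _ _) _; apply: le_trans rl; rewrite lerD2l.
  - rewrite Re_add Re_opp (le_trans (ler_normB _ _))//.
    by rewrite -lerBrDl; apply: le_trans h1; exact: normRe_le.
  - rewrite Im_add Im_opp (le_trans (ler_normB _ _))//.
    by rewrite -lerBrDl; apply: le_trans h2; exact: normIm_le.
have OP m : normc m <= r -> Omega (P + m *: b1).
  by move=> mr; have [d1 d2 d3] := inD m mr; rewrite -gE;
    apply: (tube _ _ d1 (hbox _ d2 d3)).1.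
have := su P b1 r r0 OP.
(* The cross terms in the expansions of |m0 - E|^2 and |l0 + m|^2: their real part is that of a
   polynomial vanishing at 0, hence has mean 0. *)
pose Q : {poly R[i]} := (((- (2 * A))%:C)%C * (m0^*)%C) *: ('X ^+ 2 * T)
   + (((- (2 * k))%:C)%C * (l0^*)%C) *: 'X.
have cQ := (continuous_horner_cis r Q).1.
have cc := continuous_on_circle cu (ltW r0) OP.
pose K1 := u P + r ^+ 2 * (A * C ^+ 2 * r - k).
have bound t : u (P + ccirc r t *: b1) <= Re Q.[(r%:C)%C * cis t] + K1.
  rewrite /K1 -/(ccirc r t); set m := ccirc r t.
  have nm : normc m = r by rewrite /m normc_ccirc gtr0_norm.
  have mr : normc m <= r by rewrite nm.
  have [d1 d2 d3] := inD m mr.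
  have := hmax _ _ d1 d2 d3; rewrite gE !normcD_sq normc_opp nm -/P.
  have -> : Re Q.[m] = - (2 * A) * Re (m0^* * E m)%C - 2 * k * Re (l0^* * m)%C.
    rewrite /Q hornerD !hornerZ hornerM hornerXn hornerX -/(E m) -!mulrA Re_add.
    by rewrite [Re (_ * (m0^* * _))%C]Re_mul [Re (_ * (l0^* * _))%C]Re_mul
      !(Re_real, Im_real) !mul0r !subr0 mulNr; ring.
  have -> : Re (m0^* * - E m)%C = - Re (m0^* * E m)%C by rewrite mulrN Re_opp.
  have e4 : normc (E m) ^+ 2 <= C ^+ 2 * r * r ^+ 2.
    apply: (@le_trans _ _ ((C * r ^+ 2) ^+ 2)).
      have e0 : 0 <= C * r ^+ 2 by rewrite mulr_ge0 ?sqr_ge0.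
      by apply: lerXn2r; rewrite ?nnegrE ?normc_ge0//; exact: EC.
    rewrite exprMn -mulrA ler_wpM2l ?sqr_ge0// expr2.
    by rewrite ler_wpM2r ?sqr_ge0.
  have : A * normc (E m) ^+ 2 <= A * (C ^+ 2 * r * r ^+ 2) by rewrite ler_pM2l.
  move: (Re (m0^* * E m)%C) (Re (l0^* * m)%C) (normc (E m) ^+ 2) (u (P + m *:
    b1)) (u P) => X Y N4 U UP.
  move: (normc m0 ^+ 2) (normc l0 ^+ 2) => NM NL h2 h1; rewrite -subr_ge0.
  rewrite [X in 0 <= X](_ : _ = (UP - A * NM + k * NL -
      (U - A * (NM + 2 * - X + N4) + k * (NL + 2 * Y + r ^+ 2))) +
      (A * (C ^+ 2 * r * r ^+ 2) - A * N4)); last by ring.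
  by rewrite addr_ge0// subr_ge0.
have cK1 : continuous (fun _ : R => K1) by move=> ?; exact: cvg_cst.
have cQK : continuous (fun t => Re Q.[(r%:C)%C * cis t] + K1).
  by move=> t; exact: (cvgD (cQ t) (cK1 t)).
have := le_cmean cc cQK (fun t _ => bound t).
rewrite cmeanD// cmean_cst cmean_poly.
have -> : Re Q.[0] = 0.
  by rewrite /Q hornerD !hornerZ hornerM hornerXn hornerX expr0n /= !(mul0r,
    mulr0, addr0).
rewrite add0r => h1 h2; have := le_trans h2 h1; rewrite /K1.
have : r ^+ 2 * (A * C ^+ 2 * r - k) < 0 by rewrite pmulr_rlt0 ?exprn_gt0//
  subr_lt0.
lra.
Qed.

End MaxPrinciple.

(** * Oka's lemma *)

Section Oka.
Variables (R : realType) (n : nat).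
Implicit Types (x y z w b c : Cn R n) (Omega : set (Cn R n)) (l : R[i]) (q :
  {poly R[i]}).
Local Notation Re := (@complex.Re R).
Local Notation Im := (@complex.Im R).
Local Notation normc := (@Normc.normc R).

Lemma polar l : normc l = 1 -> exists2 t : R, - pi <= t <= pi & l = cis t.
Proof.
move=> l1; have l2 := normc_sq l; rewrite l1 expr1n in l2.
have r1 : -1 <= Re l <= 1 by rewrite -ler_norml -l1 normRe_le.
have p0 := acos_ge0 r1; have p1 := acos_lepi r1; have pi0 := pi_gt0 R.
have sE : sin (acos (Re l)) = `|Im l|.
  rewrite sin_acos// -[X in Num.sqrt (X - _)]/(1) {1}l2 addrC addKr sqrtr_sqr//.
case: (leP 0 (Im l)) => i0.
  exists (acos (Re l)); first by lra.
  by rewrite /cis acosK// sE ger0_norm//; case: (l).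
exists (- acos (Re l)); first by lra.
by rewrite /cis cosN sinN acosK// sE ltr0_norm// opprK; case: (l).
Qed.

Lemma normc_cis1 (t : R) : normc (cis t) = 1.
Proof. by have := normc_cis 1 t; rewrite mul1r normr1. Qed.

(** The family of discs is traversed in finitely many steps of s. All boundary circles lie in one
    compact set, where phi <= M; the maximum principle carries this bound to each whole disc, which
    then stays at distance at least d from the boundary, and the next disc is less than d away. *)
Lemma disc_ball Omega z b q : open Omega -> boundary Omega !=set0 ->
  pseudoconvex Omega ->
  (forall l, normc l <= 1 -> Omega (z + l *: b)) ->
  (forall l, normc l = 1 -> normc q.[l] < bdist Omega (z + l *: b)) ->
  normc q.[0] <= bdist Omega z.
Proof.
move=> oO b0 [phi [phipsh phic exh]] D qd.
have cphi x : Omega x -> phi y @[y --> x] --> phi x.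
  by move=> Ox; apply: phic; rewrite inE.
have sphi := psh_submean cphi phipsh.
apply: bdist_ge => // y yz.
have q00 : 0 < normc q.[0] by apply: le_lt_trans yz; exact: enorm_ge0.
have q0 : q.[0] != 0 by apply/negP => /eqP E;
  rewrite E Normc.normc0 ltxx in q00.
(* With this direction the last disc, s = 1, passes through y at l = 0. *)
pose c := q.[0]^-1 *: (y - z).
have c1 : enorm c <= 1.
  by rewrite enormZ Normc.normcV mulrC ler_pdivrMr// mul1r ltW.
have yE : y = z + q.[0] *: c by rewrite /c scalerA mulfV// scale1r addrC subrK.
pose g (s : R) l : Cn R n := z + l *: b + ((s%:C)%C *: q).[l] *: c.
have circ (s : R) l : 0 <= s <= 1 -> normc l = 1 -> Omega (g s l).
  move=> /andP[s0 s1] l1; apply: (bdist_ball (z := z + l *: b)) => //.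
    by apply: D; rewrite l1.
  rewrite /g addrC addKr enormZ hornerZ Normc.normcM normc_real ger0_norm//.
  apply: le_lt_trans (qd l l1); rewrite mulrAC mulrC ler_piMr ?normc_ge0//.
  by rewrite mulr_ile1 ?enorm_ge0.
have [M hM] : exists M, forall (s : R) l, 0 <= s <= 1 -> normc l = 1 ->
  phi (g s l) <= M.
  pose K : set (R * R) := `[- pi, pi]%classic `*` `[0, 1]%classic.
  have cK : compact K by apply: compact_setX; exact: segment_compact.
  have K0 : K !=set0.
    by exists (0, 0); split; rewrite /= in_itv/= ?lexx ?ler01// oppr_le0 andbb
      pi_ge0.
  have cont : {within K, continuous (fun p : R * R => phi (g p.2 (cis p.1)))}.
    apply: continuous_in_subspaceT => p /set_mem[/= p1 p2].
    rewrite in_itv/= in p2.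
    apply: (@cvg_comp _ _ _ (fun p : R * R => g p.2 (cis p.1)) phi); last first.
      by apply: cphi; apply: circ => //; exact: normc_cis1.
    have f1 : s.1 @[s --> p] --> p.1 by exact: cvg_fst.
    have f2 : s.2 @[s --> p] --> p.2 by exact: cvg_snd.
    have g1 : Re (cis s.1) @[s --> p] --> Re (cis p.1).
      exact: (cvg_comp _ _ f1 (@continuous_cos R p.1)).
    have g2 : Im (cis s.1) @[s --> p] --> Im (cis p.1).
      exact: (cvg_comp _ _ f1 (@continuous_sin R p.1)).
    have [h1 h2] := horner_continuous q g1 g2.
    apply: cvgD.
      by apply: cvgD; [exact: cvg_cst|exact: cvg_scale].
    apply: cvg_scale.
      under eq_fun do rewrite hornerZ Re_mul Re_real Im_real mul0r subr0.
      by rewrite hornerZ Re_mul Re_real Im_real mul0r subr0; apply: cvgM.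
    under eq_fun do rewrite hornerZ Im_mul Re_real Im_real mul0r addr0.
    by rewrite hornerZ Im_mul Re_real Im_real mul0r addr0; apply: cvgM.
  have [pm _ hpm] := compact_EVT_max K0 cK cont.
  exists (phi (g pm.2 (cis pm.1))) => s l s01 /polar[t tpi ->].
  by have := hpm (t, s); apply; rewrite inE; split; rewrite /= in_itv.
have [d d0 hd] := exh M.
have [Q Q0 hQ] := horner_bounded q.
pose m := (Num.trunc (Q / d)).+1.
have md : Q / m%:R < d.
  by rewrite ltr_pdivrMr ?ltr0n// mulrC -ltr_pdivrMr// truncnS_gt.
have m0 : 0 < m%:R :> R by rewrite ltr0n.
have step k : (k <= m)%N -> forall l, normc l <= 1 -> Omega (g (k%:R / m%:R) l).
  elim: k => [_ l l1|k IH km l l1].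
    by rewrite /g mul0r scale0r horner0 scale0r addr0; exact: D.
  have k01 : 0 <= (k%:R / m%:R : R) <= 1.
    by rewrite divr_ge0//= ler_pdivrMr// mul1r ler_nat ltnW.
  have h1 : phi (g (k%:R / m%:R) l) <= M.
    apply: (@disc_max_principle _ _ Omega phi z b c ((k%:R / m%:R)%:C%C *: q)
      M) => //.
      exact: (IH (ltnW km)).
    by move=> l' l'1; apply: hM.
  apply: (bdist_ball (z := g (k%:R / m%:R) l)) => //;
    first exact: (IH (ltnW km)).
  apply: (@lt_le_trans _ _ d); last first.
    rewrite leNgt; apply/negP => /(hd _ (IH (ltnW km) _ l1)); apply/negP.
    by rewrite -leNgt.
  apply: le_lt_trans md.
  have -> : g (k.+1%:R / m%:R) l - g (k%:R / m%:R) l = (((m%:R^-1)%:C)%C *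
    q.[l]) *: c.
    apply/rowP => i; rewrite /g !mxE !hornerZ -natr1 mulrDl mul1r rmorphD /=;
      ring.
  rewrite enormZ Normc.normcM normc_real gtr0_norm ?invr_gt0// -mulrA mulrC.
  apply: ler_wpM2r; first by rewrite invr_ge0 ltW.
  rewrite -[Q]mulr1; apply: ler_pM; rewrite ?enorm_ge0 ?normc_ge0//.
  exact: hQ.
have := step m (leqnn m) 0; rewrite Normc.normc0 => /(_ ler01).
by rewrite /g divff ?gt_eqF// scale1r scale0r addr0 -yE.
Qed.

(** From exp (- x) >= 1 - x and (1 + y) (1 - y + 2 y^2) = 1 + y^2 (1 + 2 y) >= 1. It bounds (1 + x /
    N) ^ N from below. *)
Lemma expR_sub_le1Dx (y : R) : `|y| <= 2^-1 -> expR (y - 2 * y ^+ 2) <= 1 + y.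
Proof.
rewrite ler_norml => /andP[y1 y2].
have h1 : 0 < 1 + y by lra.
have h2 : 0 < 1 - y + 2 * y ^+ 2 by have := sqr_ge0 y; lra.
have h3 := expR_ge1Dx (- (y - 2 * y ^+ 2)).
have h4 : 1 - y + 2 * y ^+ 2 <= (expR (y - 2 * y ^+ 2))^-1 by rewrite -expRN;
  lra.
have h5 : expR (y - 2 * y ^+ 2) <= (1 - y + 2 * y ^+ 2)^-1.
  by rewrite -[leLHS]invrK lef_pV2// posrE ?invr_gt0 ?expR_gt0.
apply: le_trans h5 _; rewrite -[leLHS]mul1r ler_pdivrMr//.
have : 0 <= y ^+ 2 * (1 + 2 * y) by rewrite mulr_ge0 ?sqr_ge0//; lra.
by rewrite (_ : (1 + y) * (1 - y + 2 * y ^+ 2) = 1 + y ^+ 2 * (1 + 2 * y))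
  ?lerDl//; ring.
Qed.

(* [exp P] on the disc is replaced by the polynomial [(1 + P / N) ^ N]. *)
Lemma exp_poly_approx (P : {poly R[i]}) (e : R) : 0 < e -> Im P.[0] = 0 ->
  exists q : {poly R[i]},
    (forall l, normc l <= 1 -> normc q.[l] <= expR (Re P.[l] + e)) /\
    expR (Re P.[0] - e) <= normc q.[0].
Proof.
move=> e0 P0.
have [B B0 hB] := horner_bounded P.
pose x := Re P.[0].
have xB : `|x| <= B.
  by apply: le_trans (normRe_le _) _; apply: hB; rewrite Normc.normc0.
(* N makes B / N <= 1 / 2, as [expR_sub_le1Dx] requires, and 2 B^2 / N <= e, which controls both
   quadratic errors. *)
pose N := (Num.trunc (2 * B + (2 * B ^+ 2) / e)).+1.
have N0 : 0 < N%:R :> R by rewrite ltr0n.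
have hN : 2 * B + (2 * B ^+ 2) / e < N%:R by rewrite truncnS_gt.
have t0 : 0 <= (2 * B ^+ 2) / e by rewrite divr_ge0 ?mulr_ge0 ?sqr_ge0// ltW.
have hN1 : B <= N%:R / 2 by lra.
have hN2 : 2 * B ^+ 2 <= e * N%:R by rewrite [leRHS]mulrC -ler_pdivrMr//;
  move: t0 hN; set X := _ / e; lra.
exists ((1 + ((N%:R^-1)%:C)%C *: P) ^+ N).
have E l : ((1 + ((N%:R^-1)%:C)%C *: P) ^+ N).[l] = (1 + ((N%:R^-1)%:C)%C *
  P.[l]) ^+ N.
  by rewrite horner_exp hornerD hornerZ hornerC.
have normX (m : R[i]) k : normc (m ^+ k) = normc m ^+ k.
  by elim: k => [|k IH]; rewrite ?expr0 ?Normc.normc1// !exprS Normc.normcM IH.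
split=> [l l1|]; rewrite E normX.
  rewrite -(@ler_pXn2r _ 2)// ?nnegrE ?exprn_ge0 ?normc_ge0 ?expR_ge0//.
  have EQ : normc (1 + ((N%:R^-1)%:C)%C * P.[l]) ^+ 2 =
      1 + 2 * (N%:R^-1 * Re P.[l]) + N%:R ^- 2 * normc P.[l] ^+ 2.
    rewrite normcD_sq Normc.normc1 expr1n Normc.normcM normc_real.
    have iN : 0 <= N%:R^-1 :> R by rewrite invr_ge0 ltW.
    rewrite (ger0_norm iN) exprMn exprVn.
    by rewrite Re_mul Re_mul Im_mul /= oppr0 !mul0r mul1r !subr0.
  rewrite exprAC EQ -expRM_natl.
  have h1 : 1 + 2 * (N%:R^-1 * Re P.[l]) + N%:R ^- 2 * normc P.[l] ^+ 2 <=
    expR (N%:R^-1 * (2 * (Re P.[l] + e))).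
    apply: le_trans (expR_ge1Dx _); rewrite -addrA lerD2l !mulrDr.
    rewrite [N%:R^-1 * (2 * _)]mulrCA lerD2l.
    rewrite -exprVn expr2 -mulrA ler_pM2l ?invr_gt0//.
    rewrite ler_pdivrMl//.
    have : normc P.[l] ^+ 2 <= B ^+ 2.
      by apply: lerXn2r; rewrite ?nnegrE ?normc_ge0//; exact: hB.
    have := sqr_ge0 B; have := e0; lra.
  have h2 : 0 <= 1 + 2 * (N%:R^-1 * Re P.[l]) + N%:R ^- 2 * normc P.[l] ^+ 2.
    by rewrite -EQ sqr_ge0.
  apply: le_trans (lerXn2r N h2 _ h1) _; first by rewrite nnegrE expR_ge0.
  by rewrite -expRM_natl mulrA mulfV ?gt_eqF// mul1r.
have -> : 1 + ((N%:R^-1)%:C)%C * P.[0] = ((1 + N%:R^-1 * x)%:C)%C.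
  by apply/eqP; rewrite eq_complex !complexE /= P0 !mulr0 !mul0r /x;
    apply/andP; split; apply/eqP; ring.
have y2 : `|N%:R^-1 * x| <= 2^-1.
  rewrite normrM gtr0_norm ?invr_gt0// mulrC ler_pdivrMr//; lra.
have h1 := expR_sub_le1Dx y2.
have h2 : 0 <= 1 + N%:R^-1 * x := le_trans (expR_ge0 _) h1.
rewrite normc_real ger0_norm//.
apply: (@le_trans _ _ (expR (N%:R^-1 * x - 2 * (N%:R^-1 * x) ^+ 2) ^+ N));
  last first.
  by apply: lerXn2r; rewrite ?nnegrE ?expR_ge0.
rewrite -expRM_natl ler_expR mulrBr mulrA mulfV ?gt_eqF// mul1r -/x lerD2l
  lerN2.
rewrite (_ : N%:R * (2 * (N%:R^-1 * x) ^+ 2) = (2 * x ^+ 2) / N%:R); last first.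
  by field; rewrite gt_eqF.
rewrite ler_pdivrMr//.
have : x ^+ 2 <= B ^+ 2.
  by rewrite -(real_normK (num_real x)); apply: lerXn2r; rewrite ?nnegrE.
lra.
Qed.

Lemma ln_bdist_continuous Omega x : open Omega -> boundary Omega !=set0 ->
  Omega x ->
  ln (bdist Omega y) @[y --> x] --> ln (bdist Omega x).
Proof.
move=> oO b0 Ox; have cl := continuous_ln (bdist_gt0 oO b0 Ox).
exact: (@continuous_comp _ _ _ (bdist Omega) (@ln R) x (@bdist_continuous _ _ _
  b0 x) cl).
Qed.

Theorem oka Omega : open Omega -> boundary Omega !=set0 -> pseudoconvex Omega ->
  submean_on Omega (fun z => - ln (bdist Omega z)).
Proof.
move=> oO b0 pc z b r r0 D.
have cu x : Omega x -> - ln (bdist Omega y) @[y --> x] --> - ln (bdist Omega x).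
  by move=> Ox; have := ln_bdist_continuous oO b0 Ox => /cvgN.
have ch := continuous_on_circle cu (ltW r0) D.
pose b' := (r%:C)%C *: b.
pose h t := ln (bdist Omega (z + cis t *: b')).
have cE t : z + ccirc r t *: b = z + cis t *: b' by rewrite /ccirc /b' scalerA
  mulrC.
have D' l : normc l <= 1 -> Omega (z + l *: b').
  move=> l1; rewrite /b' scalerA; apply: D.
  by rewrite Normc.normcM normc_real gtr0_norm// ler_piMl// ltW.
have ch' : continuous h.
  have -> : h = (fun t => - - ln (bdist Omega (z + ccirc r t *: b))).
    by apply/funext => t; rewrite opprK cE.
  by move=> t; exact: (cvgN (ch t)).
have ph : periodic h (2 * pi).
  by move=> t; rewrite /h /cis mulr_natl cosD2pi sinD2pi.
apply/ler_addgt0Pr => e' e'0.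
have e0 : 0 < e' / 5 by rewrite divr_gt0.
set e := e' / 5 in e0.
have [p hp] := trig_approx ch' ph e0.
(* Lowering p by 2 e leaves room for both approximation errors and makes |q| < delta strict on the
   circle; the imaginary part is removed so that P is real at 0. In the end the errors add up to 7 e
   / 2, below e' = 5 e. *)
pose P : {poly R[i]} := p - ((2 * e) +i* Im p.[0])%C%:P.
have PR l : Re P.[l] = Re p.[l] - 2 * e by rewrite /P hornerD hornerN hornerC
  Re_add Re_opp.
have P0 : Im P.[0] = 0 by rewrite /P hornerD hornerN hornerC Im_add Im_opp /=
  subrr.
have e20 : 0 < e / 2 by rewrite divr_gt0.
have [q [q1 q0]] := exp_poly_approx e20 P0.
have hq : normc q.[0] <= bdist Omega z.
  apply: (disc_ball (b := b')) => // l l1.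
  have := q1 l; rewrite l1 lexx => /(_ isT) /le_lt_trans; apply.
  have Ol : Omega (z + l *: b') by apply: D'; rewrite l1.
  rewrite -[ltRHS]lnK ?posrE; last exact: bdist_gt0.
  rewrite ltr_expR PR.
  have [t tpi lE] := polar l1.
  have tI : - pi <= t <= 2 * pi by have := pi_gt0 R; move: tpi; clear; lra.
  by have := hp t tI; rewrite /h -lE ler_norml => /andP[_]; move: e0; lra.
have lnq : Re P.[0] - e / 2 <= ln (bdist Omega z).
  rewrite -[leLHS]expRK ler_ln ?posrE ?expR_gt0//; first exact: le_trans hq.
  by apply: lt_le_trans hq; apply: lt_le_trans q0; exact: expR_gt0.
have -> : cmean (fun t => - ln (bdist Omega (z + ccirc r t *: b))) = - cmean h.
  rewrite -mulN1r -cmeanZ//; congr cmean; apply/funext => t.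
  by rewrite mulN1r /h cE.
have mh : cmean h <= Re p.[0] + e.
  by have := cmean_approx ch' hp; rewrite ler_norml => /andP[+ _]; lra.
rewrite PR in lnq; rewrite /e in lnq mh *; lra.
Qed.

End Oka.

(** * Locality of plurisubharmonicity *)

Section LocalToGlobal.
Variables (R : realType) (n : nat).
Implicit Types (x y z w b c : Cn R n) (Omega : set (Cn R n)) (l : R[i]) (q :
  {poly R[i]}).
Local Notation Re := (@complex.Re R).
Local Notation Im := (@complex.Im R).
Local Notation normc := (@Normc.normc R).

(** The radius may depend on the point and on b: the glued function is compared with its members
    only on circles so small that the relevant indices do not change. *)
Definition local_submean (u : Cn R n -> R) z : Prop :=
  forall b, exists2 r0 : R, 0 < r0 &
    forall r : R, 0 < r < r0 -> u z <= cmean (fun t => u (z + ccirc r t *: b)).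

(* A trigonometric approximation of the boundary values plays the role of the
   Poisson integral. *)
Lemma local_submean_on Omega (u : Cn R n -> R) :
  (forall z, Omega z -> u y @[y --> z] --> u z) ->
  (forall z, Omega z -> local_submean u z) -> submean_on Omega u.
Proof.
move=> cu lu z b r r0 D.
have ch := continuous_on_circle cu (ltW r0) D.
pose b' := (r%:C)%C *: b.
pose h t := u (z + cis t *: b').
have cE t : z + ccirc r t *: b = z + cis t *: b' by rewrite /ccirc /b' scalerA
  mulrC.
have hE : (fun t => u (z + ccirc r t *: b)) = h by apply/funext => t;
  rewrite cE.
rewrite hE in ch *.
have D' l : normc l <= 1 -> Omega (z + l *: b').
  move=> l1; rewrite /b' scalerA; apply: D.
  by rewrite Normc.normcM normc_real gtr0_norm// ler_piMl// ltW.
have ph : periodic h (2 * pi).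
  by move=> t; rewrite /h /cis mulr_natl cosD2pi sinD2pi.
apply/ler_addgt0Pr => e' e'0.
have e0 : 0 < e' / 3 by rewrite divr_gt0.
set e := e' / 3 in e0.
have [p hp] := trig_approx ch ph e0.
have := cmean_approx ch hp; rewrite ler_norml => /andP[_ mh].
(* The strictly subharmonic term e |l|^2 excludes interior maxima and costs at most e. *)
pose psi (s : R * R) := u (z + cpair s *: b') - Re p.[cpair s] + e * normc
  (cpair s) ^+ 2.
have cpsi : {within @udisc R, continuous psi}.
  apply: continuous_in_subspaceT => s /set_mem sD.
  have cs : (z + cpair s' *: b' : Cn R n) @[s' --> s] --> (z + cpair s *: b' :
    Cn R n).
    by apply: cvgD; [exact: cvg_cst|apply: cpair_continuous; exact: cvg_id].
  have c1 : Re (cpair s') @[s' --> s] --> Re (cpair s) by exact: cvg_fst.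
  have c2 : Im (cpair s') @[s' --> s] --> Im (cpair s) by exact: cvg_snd.
  have c3 := (horner_continuous p c1 c2).1.
  have c4 := @normc_cpair_sq_cvg R _ _ (nbhs_filter s) id s cvg_id.
  apply: cvgD; last by apply: cvgM; [exact: cvg_cst|exact: c4].
  apply: cvgB; last exact: c3.
  exact: (@continuous_comp _ _ _ (fun s' : R * R =>
    z + cpair s' *: b' : Cn R n) u s cs (cu _ (D' _ sD))).
have u0 : @udisc R !=set0 by exists (0, 0); rewrite /udisc /= Normc.normc0.
have [s0 /set_mem s0D hmax] := compact_EVT_max u0 (@udisc_compact R) cpsi.
set l0 := cpair s0 in s0D.
have {}hmax l : normc l <= 1 -> u (z + l *: b') - Re p.[l] + e * normc l ^+ 2 <=
    u (z + l0 *: b') - Re p.[l0] + e * normc l0 ^+ 2.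
  by move=> ln; have := hmax (Re l, Im l); rewrite /psi /cpair /=;
    case: l ln => ? ? ln; apply; rewrite inE.
(* At an interior maximum, averaging over a circle of radius rho would raise e |l|^2 by e rho^2,
   while [Re p] keeps its value and the mean of [u] does not drop. *)
have l01 : normc l0 = 1.
  apply/eqP; rewrite eq_le s0D leNgt; apply/negP => l01.
  have Oz : Omega (z + l0 *: b') by exact: D'.
  have [r1 r10 hr1] := lu _ Oz b'.
  pose rho := Num.min (r1 / 2) (1 - normc l0).
  have rho0 : 0 < rho by rewrite lt_min subr_gt0 l01 divr_gt0.
  have rhor : rho < r1.
    by rewrite gt_min; apply/orP; left; rewrite ltr_pdivrMr// ltr_pMr// ltr1n.
  have rhol : normc l0 + rho <= 1.
    by rewrite -lerBrDl ge_min lexx orbT.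
  have inD m : normc m <= rho -> normc (l0 + m) <= 1.
    by move=> mr; apply: le_trans (le_normcD _ _) _; apply: le_trans rhol;
      rewrite lerD2l.
  have := hr1 rho; rewrite rho0 rhor => /(_ isT).
  have OP m : normc m <= rho -> Omega (z + l0 *: b' + m *: b').
    by move=> mr; rewrite -addrA -scalerDl; apply: D'; exact: inD.
  have cc := continuous_on_circle cu (ltW rho0) OP.
  pose Q : {poly R[i]} := p \Po ('X + l0%:P) - p.[l0]%:P
    - (((2 * e)%:C)%C * (l0^*)%C) *: 'X.
  have QE m : Re Q.[m] = Re p.[l0 + m] - Re p.[l0] - 2 * e * Re ((l0^*)%C * m).
    rewrite /Q !hornerD !hornerN hornerZ horner_comp hornerC hornerX hornerD
      hornerX hornerC !Re_add !Re_opp.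
    have -> : Re (((2 * e)%:C)%C * (l0^*)%C * m) = 2 * e * Re ((l0^*)%C * m).
      by rewrite -mulrA; case: ((l0^*)%C * m) => X Y;
        rewrite Re_mul /= mul0r subr0.
    by rewrite [m + l0]addrC.
  have cQ := (continuous_horner_cis rho Q).1.
  pose K1 := u (z + l0 *: b') - e * rho ^+ 2.
  have cK1 : continuous (fun _ : R => K1) by move=> ?; exact: cvg_cst.
  have bound t : u (z + l0 *: b' + ccirc rho t *: b') <= Re Q.[(rho%:C)%C * cis
    t] + K1.
    rewrite -/(ccirc rho t); set m := ccirc rho t.
    have nm : normc m = rho by rewrite /m normc_ccirc gtr0_norm.
    have := hmax (l0 + m); rewrite inD ?nm// normcD_sq nm scalerDl addrA QE /K1
      => /(_ isT).
    move: (Re (l0^* * m)%C) (Re p.[l0 + m]) (Re p.[l0]) => X Y Z.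
    move: (u (z + l0 *: b' + m *: b')) (u (z + l0 *: b')) (normc l0 ^+ 2) =>
      U V W H.
    rewrite -subr_ge0 [X in 0 <= X](_ : _ = V - Z + e * W - (U - Y + e * (W + 2
      * X + rho ^+ 2))); last by ring.
    by rewrite subr_ge0.
  have cQK : continuous (fun t => Re Q.[(rho%:C)%C * cis t] + K1).
    by move=> t; exact: (cvgD (cQ t) (cK1 t)).
  have := le_cmean cc cQK (fun t _ => bound t).
  rewrite cmeanD// cmean_cst cmean_poly QE mulr0 addr0 subrr /= mulr0 subr0
    add0r => h1 h2.
  have h3 := le_trans h2 h1;
    have h4 : 0 < e * rho ^+ 2 by rewrite mulr_gt0// exprn_gt0.
  by move: h3 h4; rewrite /K1; clear; lra.
have [t tpi lE] := polar l01.
have tI : - pi <= t <= 2 * pi by have := pi_gt0 R; move: tpi; clear; lra.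
have := hp t tI; rewrite /h -lE ler_norml => /andP[h1 _].
have := hmax 0; rewrite Normc.normc0 ler01 l01 scale0r addr0 => /(_ isT).
rewrite expr0n expr1n /= mulr0 addr0 mulr1.
have eE : e' = 3 * e by rewrite /e; field.
by rewrite eE; move: mh h1; clear; lra.
Qed.

Lemma local_submean_psh Omega (u : Cn R n -> R) :
  (forall z, Omega z -> u y @[y --> z] --> u z) ->
  (forall z, Omega z -> local_submean u z) -> psh Omega (EFin \o u).
Proof.
move=> cu lu; have su := local_submean_on cu lu.
have usc z (a : R) : Omega z -> ((EFin \o u) z < a%:E)%E ->
  \forall y \near z, ((EFin \o u) y < a%:E)%E.
  move=> Oz; rewrite /= lte_fin => uza.
  have h := (@real_cvgP _ _ _ (nbhs_filter z) _ _).1 (cu _ Oz) (a - u z).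
  rewrite subr_gt0 in h; have := h uza; apply: filterS => y.
  by rewrite lte_fin ltr_norml ltrD2r => /andP[].
split=> [z _|z Oz a /(usc _ _ Oz)|a b]; first exact: ltry.
  by apply: filterS.
split=> [z _|l Ol s|l r r0 D]; first exact: ltry.
  move=> /= /(usc _ _ Ol).
  have cl : continuous (fun l : Cplx R => a + l *: b : Cn R n).
    move=> l'.
    have h : (l *: b : Cn R n) @[l --> l'] --> (l' *: b : Cn R n) by exact:
      scalel_continuous.
    have FF : Filter (nbhs l') by exact: nbhs_filter.
    have := @cvgD R[i] (Cn R n) (Cplx R) (nbhs l') FF (fun _ => a) (fun l =>
      l *: b) a (l' *: b).
    by apply; [exact: cvg_cst|exact: h].
  move=> H; have H2 : nbhs l (fun l' : Cplx R =>
    ((u (a + l' *: b))%:E < s%:E)%E) := cl l _ H.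
  by apply: (@filterS _ (nbhs l) (nbhs_filter l) _ _ _ H2) => y yH _.
have E t : a + circle l r t *: b = (a + l *: b) + ccirc r t *: b.
  by rewrite /circle scalerDl addrA.
have D' m : normc m <= r -> Omega (a + l *: b + m *: b).
  move=> mr; rewrite -addrA -scalerDl; apply: D.
  by rewrite addrC addKr normCE lecR.
have -> : (fun t => (EFin \o u) (a + circle l r t *: b)) =
          (fun t => (u (a + l *: b + ccirc r t *: b))%:E).
  by apply/funext => t /=; rewrite E.
rewrite cmeanE; last exact: (continuous_on_circle cu (ltW r0) D').
by rewrite lee_fin; exact: su.
Qed.

End LocalToGlobal.

(** * Linear forms on complex lines, covering margin and logarithmic bounds *)

Section Prelim.
Variables (R : realType) (n : nat).
Implicit Types (x y z w b c : Cn R n) (Omega : set (Cn R n)) (l : R[i]).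
Local Notation Re := (@complex.Re R).
Local Notation Im := (@complex.Im R).
Local Notation normc := (@Normc.normc R).

(** Along a complex line a real linear form is the real part of a linear polynomial; this makes the
    affine cutoffs pluriharmonic. *)
Lemma rdot_scale l b x : rdot (l *: b) x =
  Re (l * \sum_i (b 0 i * ((x 0 i)^*)%C)).
Proof.
rewrite mulr_sumr /rdot.
have -> : forall F : 'I_n.+1 -> R[i], Re (\sum_i F i) = \sum_i Re (F i).
  by move=> F; elim/big_ind2: _ => // a a' c c' <- <-; rewrite Re_add.
apply: eq_bigr => i _; rewrite mxE;
  case: l (b 0 i) (x 0 i) => [? ?] [? ?] [? ?].
by rewrite !complexE /=; ring.
Qed.

Lemma rdot_circE z b x (r : R) : (fun t => rdot (z + ccirc r t *: b) x) =
  (fun t => rdot z x +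
     Re ((\sum_i (b 0 i * ((x 0 i)^*)%C)) *: 'X).[(r%:C)%C * cis t]).
Proof. by apply/funext => t;
  rewrite rdotDl rdot_scale hornerZ hornerX mulrC. Qed.

Lemma rdot_circ_continuous z b x (r : R) : continuous (fun t =>
  rdot (z + ccirc r t *: b) x).
Proof.
rewrite rdot_circE => t; set H := \sum_i _.
exact: (cvgD (@cvg_cst _ _ _ _ _) ((continuous_horner_cis r (H *: 'X)).1 t)).
Qed.

Lemma cmean_rdot z b x (r : R) : cmean (fun t =>
  rdot (z + ccirc r t *: b) x) = rdot z x.
Proof.
rewrite rdot_circE; set H := \sum_i _.
have cH := (continuous_horner_cis r (H *: 'X)).1.
rewrite cmeanD//; last by move=> t; exact: cvg_cst.
by rewrite cmean_cst cmean_poly hornerZ hornerX mulr0 addr0.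
Qed.

Lemma abs_rdot_le z x : `|rdot z x| <= enorm z * enorm x.
Proof.
rewrite -(@ler_pXn2r _ 2)// ?nnegrE ?mulr_ge0 ?enorm_ge0//.
by rewrite real_normK ?num_real// exprMn !enorm_sq rdot_sq.
Qed.

(** A Lebesgue number of the cover; one g serves both as width of the collar and as depth inside a
    ball. *)
Lemma boundary_cover_margin Omega N (x : 'I_N -> Cn R n) (rho : 'I_N -> R) :
  ebounded Omega -> boundary Omega !=set0 ->
  boundary Omega `<=` \bigcup_j eball (x j) (rho j) ->
  exists2 g : R, 0 < g & forall z, bdist Omega z < g ->
    exists k, enorm (z - x k) < rho k - g.
Proof.
move=> bO b0 cover.
have /compact_near_coveringP := boundary_compact bO.
move=> /(_ R (0 : R)^'+ (fun g y => forall z, enorm (z - y) < g ->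
    exists k, enorm (z - x k) < rho k - g)).
case=> [y /cover[k _ yk]|g /= g0 hg].
  rewrite /eball /= in yk.
  (* A quarter of the slack at y pays for each of the two displacements and for the margin. *)
  pose h := (rho k - enorm (y - x k)) / 4.
  have h0 : 0 < h by rewrite divr_gt0// subr_gt0.
  have hE : rho k = enorm (y - x k) + 4 * h by rewrite /h; field.
  exists (eball y h, [set d | d < h]).
    by split; [exact: nbhs_eball|exact: nbhs_right_lt].
  move=> [y' d] /= [yy' dh] z zy'; exists k.
  have h1 := ler_enormB z y' (x k); have h2 := ler_enormB y' y (x k).
  by rewrite hE; rewrite /eball /= in yy'; move: h1 h2 yy' dh zy' h0; clear;
    lra.
exists (g / 2); first by rewrite divr_gt0.
move=> z /(edist_lt b0)[y by_ zy].
apply: (hg (g / 2) _ _ y by_ z zy) => /=.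
  by rewrite sub0r normrN gtr0_norm ?divr_gt0// ltr_pdivrMr// ltr_pMr// ltr1n.
by rewrite divr_gt0.
Qed.

Lemma ln_lip (s p q : R) : 0 < s -> s <= p -> s <= q ->
  `|ln p - ln q| <= `|p - q| / s.
Proof.
move=> s0; wlog pq : p q / q <= p.
  move=> W sp sq; have [|/ltW] := leP q p; first by move=> h; exact: W.
  by move=> h; rewrite distrC [`|p - q|]distrC; exact: W.
move=> sp sq.
have q0 : 0 < q by exact: lt_le_trans sq.
have p0 : 0 < p by exact: lt_le_trans sp.
rewrite !ger0_norm ?subr_ge0// ?ler_ln ?posrE//.
rewrite -ln_div ?posrE//.
have -> : p / q = 1 + (p - q) / q by field; rewrite gt_eqF.
have t0 : 0 <= (p - q) / q by rewrite divr_ge0 ?subr_ge0// ltW.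
apply: (@le_trans _ _ ((p - q) / q)); first by apply: le_ln1Dx;
  apply: lt_le_trans t0; lra.
by rewrite ler_wpM2l ?subr_ge0// lef_pV2 ?posrE.
Qed.

Lemma ln_invr_gt0 (e : R) : 0 < e -> e < 1 -> 0 < ln e^-1.
Proof. by move=> e0 e1; apply: ln_gt0; rewrite invf_gt1. Qed.

(** The ratio tends to 1 as e tends to 0. For d < 1 it is at least 1 / 2 when e <= d^2; otherwise ln
    e^-1 < 2 ln d^-1, and the numerator is at least ln (1 + d). *)
Lemma ln_ratio_lower (d e0 : R) : 0 < d -> 0 < e0 -> e0 < 1 ->
  exists2 m : R, 0 < m & forall e, 0 < e -> e <= e0 ->
    m <= ln (1 + d / e) / ln e^-1.
Proof.
move=> d0 e00 e01.
wlog d1 : d d0 / d < 1 => [W|].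
  have h0 : 0 < Num.min d (1 / 2) by rewrite lt_min d0 divr_gt0.
  have h1 : Num.min d (1 / 2) < 1 by rewrite gt_min; apply/orP; right; lra.
  have [m m0 hm] := W _ h0 h1; exists m => // e e1 e2.
  have L0 : 0 < ln e^-1 by apply: ln_invr_gt0 => //; exact: le_lt_trans e01.
  apply: le_trans (hm e e1 e2) _; rewrite ler_pM2r ?invr_gt0// ler_ln ?posrE.
  - by rewrite lerD2l ler_pM2r ?invr_gt0// ge_min lexx.
  - by rewrite addr_gt0// divr_gt0.
  - by rewrite addr_gt0// divr_gt0.
have D0 := ln_invr_gt0 d0 d1.
have l1 : 0 < ln (1 + d) by apply: ln_gt0; lra.
exists (Num.min (1 / 2) (ln (1 + d) / (2 * ln d^-1))).
  by rewrite lt_min divr_gt0//= divr_gt0// mulr_gt0.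
move=> e e1 e2.
have ee1 : e < 1 by exact: le_lt_trans e01.
have L0 := ln_invr_gt0 e1 ee1.
have [ed|ed] := leP (2 * ln d^-1) (ln e^-1).
  rewrite ge_min; apply/orP; left; rewrite ler_pdivlMr//.
  apply: (@le_trans _ _ (ln (d / e))).
    rewrite ln_div ?posrE//; move: ed; rewrite !lnV ?posrE//; lra.
  by rewrite ler_ln ?posrE ?addr_gt0 ?divr_gt0//; lra.
rewrite ge_min; apply/orP; right.
have D20 : 0 < 2 * ln d^-1 by rewrite mulr_gt0.
apply: ler_pM; [exact: ltW|by rewrite invr_ge0 ltW| |].
- rewrite ler_ln ?posrE ?addr_gt0 ?divr_gt0// lerD2l ler_pdivlMr//.
  by rewrite ler_piMr// ltW.
- by rewrite lef_pV2 ?posrE// ltW.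
Qed.

Lemma nbhs_gt (u : Cn R n -> R) z (a : R) : u y @[y --> z] --> u z -> a < u z ->
  nbhs z [set y | a < u y].
Proof.
move=> cu au; have h := (@real_cvgP _ _ _ (nbhs_filter z) _ _).1 cu (u z - a).
rewrite subr_gt0 in h; apply: filterS (h au) => y /=.
by rewrite ltr_norml => /andP[+ _]; lra.
Qed.

Lemma lip_continuous (u : Cn R n -> R) (C : R) z :
  (forall y, `|u y - u z| <= C * enorm (y - z)) -> u y @[y --> z] --> u z.
Proof.
by move=> H; apply: (@enorm_lip_cvg _ _ _ _ C);
  exact: (@filterE _ (nbhs z) (nbhs_filter z) _ H).
Qed.

Lemma edist_point_continuous x z : enorm (y - x) @[y --> z] --> enorm (z - x).
Proof.
apply: (@lip_continuous (fun y => enorm (y - x)) 1) => y.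
by rewrite mul1r (le_trans (enorm_lip _ _))// opprB addrA subrK.
Qed.

End Prelim.

(** * Gluing *)

Section Construction.
Variables (R : realType) (n : nat) (Omega : set (Cn R n)) (N : nat).
Variables (x w : 'I_N -> Cn R n) (rho : 'I_N -> R) (f : R -> R).
Variables (e1 e0 m0 g M : R).
Implicit Types (y z b : Cn R n) (j k : 'I_N) (e : R).
Local Notation d := (bdist Omega).
Local Notation om := (omega f).
Hypotheses (oO : open Omega) (b0 : boundary Omega !=set0)
  (pc : pseudoconvex Omega) (g_gt0 : 0 < g) (rho_gt0 : forall j,
    0 < rho j) (e1_lt1 : e1 < 1)
  (margin : forall z, d z < g -> exists k, enorm (z - x k) < rho k - g)
  (bounded : forall z, Omega z -> enorm z < M)
  (growth : forall j z e, Omega z -> enorm (z - x j) < rho j -> 0 < e < e1 ->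
     d z + f e <= d (z + (e%:C)%C *: w j) <= d z + e)
  (f_ge0 : forall e, 0 <= e -> 0 <= f e)
  (om_gt0 : forall e, 0 < e < e1 -> 0 < om e)
  (om_cvg : om e @[e --> 0^'+] --> 0)
  (e0_gt0 : 0 < e0) (e0_lt1 : e0 < e1) (e0_ltg : e0 < g)
  (m0_gt0 : 0 < m0) (m0_le1 : m0 <= 1)
  (m0_le : forall e, 0 < e -> e <= e0 -> m0 <= ln (1 + e0 / f e) / ln e^-1).

(** Being g deep in ball k while at the edge of ball j makes the cutoffs differ by more than g^2;
    this slope turns that into more than 1, the number of multiples of omega e needed for
    domination. *)
Definition slope : R := 2 / g ^+ 2.
Definition cutoff j z : R := rho j ^+ 2 - rdot (x j) (x j) + 2 * rdot z (x j).
Definition cutoff_bound : R :=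
  \sum_j (rho j ^+ 2 + rdot (x j) (x j) + 2 * (M * enorm (x j))).
Definition glue_const : R := 2 * (slope * cutoff_bound) + 1.
(** The constant puts the factor of [om e] into [- [glue_const], - 1]. Its upper end cancels the
    omega e in the upper barrier, so the function is nonpositive. *)
Definition shifted_log j e z : R :=
  (ln e^-1)^-1 * - ln (d (z + (e%:C)%C *: w j)) - 1
  + om e * (slope * cutoff j z - (slope * cutoff_bound + 1)).

Lemma slope_gt0 : 0 < slope.
Proof. by rewrite divr_gt0// exprn_gt0. Qed.

(* [cutoff j z] is affine, so adding [|z|^2] has turned the cutoff
   [rho^2 - |z - x|^2] into a pluriharmonic function. *)
Lemma cutoffE j z : cutoff j z = rho j ^+ 2 - enorm (z - x j) ^+ 2 + rdot z z.
Proof.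
by rewrite enorm_sq rdotDl !rdotDr !rdotNl !rdotNr (rdotC (x j) z) /cutoff;
  ring.
Qed.

Lemma cutoff_le j z : Omega z -> `|cutoff j z| <= cutoff_bound.
Proof.
move=> Oz; rewrite /cutoff_bound (bigD1 j)//=.
have zM := ltW (bounded Oz).
have M0 : 0 <= M := le_trans (enorm_ge0 z) zM.
have h1 := abs_rdot_le z (x j).
have h2 : enorm z * enorm (x j) <= M * enorm (x j).
  by rewrite ler_wpM2r// enorm_ge0.
have h3 := rdot_ge0 (x j); have h4 := sqr_ge0 (rho j).
have h5 : 0 <= \sum_(i < N | i != j) (rho i ^+ 2 + rdot (x i) (x i) + 2 * (M *
  enorm (x i))).
  apply: sumr_ge0 => i _; rewrite !addr_ge0 ?sqr_ge0 ?rdot_ge0// mulr_ge0//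
    mulr_ge0// enorm_ge0//.
move: h1; rewrite !ler_norml /cutoff; move: h2 h3 h4 h5.
set S := \sum_(i < N | _) _;
  move: S (rho j ^+ 2) (rdot z (x j)) (rdot (x j) (x j)) (M * _) (_ * _).
by move=> *; lra.
Qed.

Lemma cutoff_bounds j z : Omega z ->
  - glue_const <= slope * cutoff j z - (slope * cutoff_bound + 1) <= -1.
Proof.
move=> /(cutoff_le j); rewrite ler_norml => /andP[h1 h2]; have K0 := slope_gt0.
have h3 : slope * cutoff j z <= slope * cutoff_bound by rewrite ler_wpM2l// ltW.
have h4 : - (slope * cutoff_bound) <= slope * cutoff j z by rewrite -mulrN
  ler_wpM2l// ltW.
by rewrite /glue_const; move: h3 h4; lra.
Qed.

Lemma glue_const_ge1 z j : Omega z -> 1 <= glue_const.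
Proof. by move=> /(cutoff_bounds j)/andP[h1 h2]; move: h1 h2; lra. Qed.

Lemma e_lt1 e : e < e1 -> e < 1. Proof. by move=> /lt_trans; apply. Qed.

Lemma lnV_gt0 e : 0 < e < e1 -> 0 < ln e^-1.
Proof. by move=> /andP[h /e_lt1]; exact: ln_invr_gt0. Qed.

Lemma omE e : 0 < e < e1 -> om e * ln e^-1 = ln (e / f e).
Proof. by move=> /lnV_gt0 L; rewrite /omega divfK// gt_eqF. Qed.

Lemma f_bounds e : 0 < e < e1 -> 0 < f e < e.
Proof.
move=> ee; have /andP[e_0 _] := ee; have L := lnV_gt0 ee.
have := mulr_gt0 (om_gt0 ee) L; rewrite omE// => h.
have f0 : 0 < f e.
  rewrite lt_neqAle f_ge0 ?(ltW e_0)// andbT; apply/negP => /eqP E.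
  by move: h; rewrite -E invr0 mulr0 ln0 ?ltxx.
rewrite f0 ltNge; apply/negP => h1.
by move: h; rewrite ltNge ln_le0// ler_pdivrMr// mul1r.
Qed.

(** In other words f e = e ^ (1 + omega e): omega is the loss in the exponent. *)
Lemma ln_f e : 0 < e < e1 -> ln (f e) = - (1 + om e) * ln e^-1.
Proof.
move=> ee; have /andP[e_0 _] := ee; have /andP[f0 _] := f_bounds ee.
rewrite mulNr mulrDl mul1r omE// ln_div ?posrE// lnV ?posrE//; ring.
Qed.

(** [bdist] is an unsigned distance, so growth at e alone does not place the shifted point inside.
    Growth at every t e with 0 < t <= 1 keeps the whole segment off the boundary. *)
Lemma shift_in j z e : Omega z -> enorm (z - x j) < rho j -> 0 < e < e1 ->
  Omega (z + (e%:C)%C *: w j).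
Proof.
move=> Oz zj ee; have /andP[e_0 ee1] := ee.
apply: open_segment => // t /andP[t0 t1] bt.
have dz := bdist_gt0 oO b0 Oz.
have [tE|t'] := eqVneq t 0.
  by move: (bdist_boundary bt); rewrite tE scale0r addr0 => E;
    rewrite E ltxx in dz.
have tp : 0 < t by rewrite lt_neqAle eq_sym t'.
have te : 0 < t * e < e1.
  by rewrite mulr_gt0//=; apply: le_lt_trans ee1; rewrite ler_piMl// ltW.
have := growth Oz zj te; move: (bdist_boundary bt).
rewrite scalerA -rmorphM /= => -> /andP[h _].
have f0 : 0 <= f (t * e) by apply: f_ge0; rewrite mulr_ge0// ltW.
by move: h f0 dz; lra.
Qed.

Lemma shifted_log_upper j z e : Omega z -> enorm (z - x j) < rho j ->
  0 < e < e1 ->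
  shifted_log j e z <= - (ln (1 + d z / f e) / ln e^-1).
Proof.
move=> Oz zj ee; have /andP[h1 _] := growth Oz zj ee.
have L := lnV_gt0 ee; have /andP[f0 fe] := f_bounds ee.
have dz := bdist_gt0 oO b0 Oz.
have O1 := om_gt0 ee; have /andP[_ h2] := cutoff_bounds j Oz.
have h3 : om e * (slope * cutoff j z - (slope * cutoff_bound + 1)) <= om e * -1.
  by rewrite ler_pM2l.
have h4 : ln (d z + f e) <= ln (d (z + (e%:C)%C *: w j)).
  by rewrite ler_ln ?posrE ?addr_gt0//; apply: lt_le_trans h1; rewrite addr_gt0.
have h5 : ln (d z + f e) = ln (f e) + ln (1 + d z / f e).
  by rewrite -lnM ?posrE ?addr_gt0 ?divr_gt0//; congr ln; field; rewrite gt_eqF.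
rewrite h5 ln_f// in h4.
have h6 : (ln e^-1)^-1 * - ln (d (z + (e%:C)%C *: w j)) <=
    1 + om e - ln (1 + d z / f e) / ln e^-1.
  rewrite ler_pdivrMl//.
  have -> : ln e^-1 * (1 + om e - ln (1 + d z / f e) / ln e^-1) =
    (1 + om e) * ln e^-1 - ln (1 + d z / f e) by field; rewrite gt_eqF.
  lra.
by rewrite /shifted_log; lra.
Qed.

Lemma shifted_log_lower j z e : Omega z -> enorm (z - x j) < rho j ->
  0 < e < e1 ->
  (ln e^-1)^-1 * - ln (d z + e) - 1 - glue_const * om e <= shifted_log j e z.
Proof.
move=> Oz zj ee; have /andP[h0 h1] := growth Oz zj ee.
have L := lnV_gt0 ee; have /andP[f0 fe] := f_bounds ee; have /andP[e_0 _] := ee.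
have dz := bdist_gt0 oO b0 Oz.
have O1 := om_gt0 ee; have /andP[h2 _] := cutoff_bounds j Oz.
have h3 : om e * - glue_const <= om e * (slope * cutoff j z - (slope *
  cutoff_bound + 1)).
  by rewrite ler_pM2l.
have h4 : ln (d (z + (e%:C)%C *: w j)) <= ln (d z + e).
  by rewrite ler_ln ?posrE ?addr_gt0//; apply: lt_le_trans h0; rewrite addr_gt0.
have h5 : (ln e^-1)^-1 * - ln (d z + e) <= (ln e^-1)^-1 * - ln (d (z + (e%:C)%C
  *: w j)).
  by rewrite ler_pM2l ?invr_gt0// lerN2.
by rewrite /shifted_log; lra.
Qed.

Lemma shifted_log_dominated j k z e : Omega z -> enorm (z - x j) < rho j ->
  enorm (z - x k) < rho k -> 0 < e < e1 ->
    1 <= slope * (cutoff k z - cutoff j z) ->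
  shifted_log j e z <= shifted_log k e z.
Proof.
move=> Oz zj zk ee hk; have /andP[j1 j2] := growth Oz zj ee;
  have /andP[k1 k2] := growth Oz zk ee.
have L := lnV_gt0 ee; have /andP[f0 fe] := f_bounds ee; have /andP[e_0 _] := ee.
have dz := bdist_gt0 oO b0 Oz.
have O1 := om_gt0 ee.
rewrite /shifted_log; move: (d z) (d (z + _ *: w j)) (d (z + _ *: w k)) dz j1
  j2 k1 k2 => D Dj Dk D0 j1 j2 k1 k2.
have h1 : ln (D + f e) <= ln Dj.
  by rewrite ler_ln ?posrE ?addr_gt0//; apply: lt_le_trans j1; rewrite addr_gt0.
have h2 : ln Dk <= ln (D + e).
  by rewrite ler_ln ?posrE ?addr_gt0//; apply: lt_le_trans k1; rewrite addr_gt0.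
(* As f e < e, the quotient (D + e) / (D + f e) is at most its value e / f e at D = 0. *)
have h3 : ln (D + e) - ln (D + f e) <= om e * ln e^-1.
  rewrite omE// -ln_div ?posrE ?addr_gt0// ler_ln ?posrE ?divr_gt0 ?addr_gt0//.
  rewrite ler_pdivrMr ?addr_gt0// mulrAC ler_pdivlMr// !mulrDl !mulrDr.
  by rewrite [e * f e]mulrC lerD2r [e * D]mulrC ler_pM2l// ltW.
have h4 : (ln e^-1)^-1 * - ln Dj - (ln e^-1)^-1 * - ln Dk <= om e.
  by rewrite -mulrBr ler_pdivrMl// [leRHS]mulrC; lra.
have h5 : om e * 1 <= om e * (slope * (cutoff k z - cutoff j z)) by rewrite
  ler_pM2l.
rewrite (mulrBr slope) mulrBr in h5; rewrite !(mulrBr (om e)).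
by lra.
Qed.

Definition lip_const (s : R) : R :=
  (ln e0^-1)^-1 / s + slope * (2 * \sum_j enorm (x j)).

Lemma enorm_le_sum j : enorm (x j) <= \sum_i enorm (x i).
Proof.
by rewrite (bigD1 j)//= lerDl; apply: sumr_ge0 => i _; exact: enorm_ge0.
Qed.

Lemma e0_range e : 0 < e -> e <= e0 -> 0 < e < e1.
Proof. by move=> -> /le_lt_trans; apply. Qed.

(** Growth gives delta (y + e w_j) >= delta y >= s, so the logarithm is (1 / s)-Lipschitz there
    whatever e is; 1 / ln e^-1 is largest at e0, and [om e <= 1] bounds the affine part. *)
Lemma shifted_log_lip (s : R) j e y z : 0 < s -> Omega y -> Omega z ->
  enorm (y - x j) < rho j -> enorm (z - x j) < rho j -> s <= d y -> s <= d z ->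
  0 < e -> e <= e0 -> om e <= 1 ->
  `|shifted_log j e y - shifted_log j e z| <= lip_const s * enorm (y - z).
Proof.
move=> s0 Oy Oz yj zj sy sz e_0 ee0 o1; have ee := e0_range e_0 ee0.
have /andP[gy _] := growth Oy yj ee; have /andP[gz _] := growth Oz zj ee.
have /andP[f0 _] := f_bounds ee; have L := lnV_gt0 ee.
have O1 := om_gt0 ee; have K0 := slope_gt0.
have h1 : `|d (y + (e%:C)%C *: w j) - d (z + (e%:C)%C *: w j)| <= enorm (y - z).
  have := edist_lip (y + (e%:C)%C *: w j) (z + (e%:C)%C *: w j) b0.
  by rewrite opprD addrACA subrr addr0.
have h2 : (ln e^-1)^-1 <= (ln e0^-1)^-1.
  rewrite lef_pV2 ?posrE//; last by apply: lnV_gt0; rewrite e0_gt0.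
  by rewrite ler_ln ?posrE ?invr_gt0// lef_pV2 ?posrE.
have h3 : `|cutoff j y - cutoff j z| <= 2 * (\sum_i enorm (x i)) * enorm (y -
  z).
  rewrite /cutoff opprD addrACA subrr add0r -mulrBr -rdotNl -rdotDl normrM
    ger0_norm//.
  rewrite -mulrA ler_pM2l// (le_trans (abs_rdot_le _ _))// mulrC.
  by rewrite ler_wpM2r ?enorm_ge0// enorm_le_sum.
rewrite /shifted_log.
move: (cutoff j y) (cutoff j z) h3 => p q h3.
move: (d (y + _)) (d (z + _)) (d y) (d z) gy gz sy sz h1 =>
  a b' c c' gy gz sy sz h1.
have h4 : `|ln a - ln b'| <= `|a - b'| / s by apply: ln_lip => //; lra.
have -> : (ln e^-1)^-1 * - ln a - 1 + om e * (slope * p - (slope * cutoff_bound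
  + 1)) -
   ((ln e^-1)^-1 * - ln b' - 1 + om e * (slope * q - (slope * cutoff_bound +
     1))) =
   - ((ln e^-1)^-1 * (ln a - ln b')) + om e * (slope * (p - q)) by ring.
rewrite (le_trans (ler_normD _ _))// normrN (normrM (om e)) (normrM slope)
  (normrM (ln e^-1)^-1) /lip_const mulrDl lerD//.
  rewrite ger0_norm ?invr_ge0 ?(ltW L)// -mulrA; apply: ler_pM;
    rewrite ?invr_ge0 ?(ltW L)//.
  by rewrite (le_trans h4)// mulrC ler_wpM2l// invr_ge0 ltW.
rewrite (gtr0_norm O1) (gtr0_norm K0) -[leRHS]mul1r.
apply: ler_pM; [exact: ltW|by apply: mulr_ge0; [exact: ltW|]|exact: o1|].
by rewrite -mulrA ler_pM2l.
Qed.

(** Oka's lemma on the disc translated by e w_j, which stays in [Omega] by [shift_in]; the affine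
    remainder has exact means. *)
Lemma shifted_log_mean j e z b (r : R) : 0 < r -> 0 < e -> e <= e0 ->
  (forall l, Normc.normc l <= r ->
    Omega (z + l *: b) /\ enorm (z + l *: b - x j) < rho j) ->
  shifted_log j e z <= cmean (fun t => shifted_log j e (z + ccirc r t *: b)) /\
  continuous (fun t => shifted_log j e (z + ccirc r t *: b)).
Proof.
move=> r0 e_0 ee0 D; have ee := e0_range e_0 ee0; have L := lnV_gt0 ee.
pose z' := z + (e%:C)%C *: w j.
have D' l : Normc.normc l <= r -> Omega (z' + l *: b).
  by move=> /D[Ol lj]; rewrite /z' addrAC; exact: shift_in.
have cu y : Omega y -> - ln (d u) @[u --> y] --> - ln (d y).
  by move=> Oy; have := ln_bdist_continuous oO b0 Oy => /cvgN.
have c1 := continuous_on_circle cu (ltW r0) D'.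
have c2 := @rdot_circ_continuous _ _ z b (x j) r.
have sm := oka oO b0 pc r0 D'.
pose A := - 1 + om e * (slope * (rho j ^+ 2 - rdot (x j) (x j)) - (slope *
  cutoff_bound + 1)).
pose B := om e * (slope * 2).
have E y : shifted_log j e y = (ln e^-1)^-1 * - ln (d (y + (e%:C)%C *: w j)) +
  (A + B * rdot y (x j)).
  by rewrite /shifted_log /cutoff /A /B; ring.
have Et : (fun t => shifted_log j e (z + ccirc r t *: b)) =
   (fun t => (ln e^-1)^-1 * - ln (d (z' + ccirc r t *: b)) + (A + B * rdot (z +
     ccirc r t *: b) (x j))).
  by apply/funext => t; rewrite E [z + _ *: b + _]addrAC.
have c3 := @continuous_cmul _ (ln e^-1)^-1 _ c1.
have c4 := @continuous_cmul _ B _ c2.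
have cA : continuous (fun _ : R => A) by move=> t; exact: cvg_cst.
have c5 : continuous (fun t => A + B * rdot (z + ccirc r t *: b) (x j)).
  by move=> t; exact: (cvgD (cA t) (c4 t)).
rewrite Et; split; last by move=> t; exact: (cvgD (c3 t) (c5 t)).
rewrite cmeanD// (cmeanD cA c4) cmean_cst !cmeanZ// cmean_rdot E lerD2r.
by rewrite ler_pM2l// invr_gt0.
Qed.

(* The restriction to [om e <= 1] makes the family equi-Lipschitz; elsewhere the
   lower bound is implied by [- m0]. *)
Definition valid j e z := [/\ enorm (z - x j) < rho j, 0 < e,
  e <= e0 & om e <= 1].

Lemma cutoff_diff_continuous k j z :
  slope * (cutoff k y - cutoff j y) @[y --> z] --> slope * (cutoff k z - cutoff
    j z).
Proof.
apply: (@lip_continuous _ _ (fun y => slope * (cutoff k y - cutoff j y))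
  (slope * (2 * enorm (x k - x j)))) => y.
have -> : slope * (cutoff k y - cutoff j y) - slope * (cutoff k z - cutoff j z)
  =
    slope * (2 * rdot (y - z) (x k - x j)).
  by rewrite /cutoff rdotDl !rdotDr !rdotNl !rdotNr; ring.
move: slope slope_gt0 => K K0;
  rewrite !normrM (gtr0_norm K0) (@ger0_norm _ 2)// -!mulrA.
by rewrite ler_pM2l// ler_pM2l// [leRHS]mulrC abs_rdot_le.
Qed.

(** Outside the collar of width e0 the truncation wins, which extends the construction to points
    that no ball covers. *)
Lemma shifted_log_deep j e z : Omega z -> valid j e z -> e0 <= d z ->
  shifted_log j e z <= - m0.
Proof.
move=> Oz [zj e_0 ee0 o1] ez; have ee := e0_range e_0 ee0.
apply: le_trans (shifted_log_upper Oz zj ee) _; rewrite lerN2.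
apply: le_trans (m0_le e_0 ee0) _.
have L := lnV_gt0 ee; have /andP[f0 fe] := f_bounds ee.
have dz := bdist_gt0 oO b0 Oz.
rewrite ler_pM2r ?invr_gt0// ler_ln ?posrE ?addr_gt0 ?divr_gt0//.
by rewrite lerD2l ler_pM2r// invr_gt0.
Qed.

(* Near every point only the indices of a fixed set J matter: those whose ball
   is being left are dominated by an index with a margin. *)
Lemma local_index z0 : Omega z0 -> exists (J : 'I_N -> Prop) (s : R),
  0 < s /\ forall y, enorm (y - z0) < s ->
  [/\ Omega y, s <= d y, forall j, J j -> enorm (y - x j) < rho j &
     forall j e, valid j e y ->
       shifted_log j e y <= - m0 \/ exists2 k,
         J k & shifted_log j e y <= shifted_log k e y].
Proof.
move=> Oz0; have dz := bdist_gt0 oO b0 Oz0.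
have nO : nbhs z0 Omega by exact: open_nbhs_nbhs.
have d2 : 0 < d z0 / 2 by rewrite divr_gt0.
have nd : nbhs z0 [set y | d z0 / 2 < d y].
  apply: nbhs_gt; first exact: bdist_continuous.
  by rewrite ltr_pdivrMr// ltr_pMr// ltr1n.
suff [J [A nA HA]] : exists (J : 'I_N ->
  Prop), exists2 A, nbhs z0 A & forall y, A y -> Omega y ->
   (forall j, J j -> enorm (y - x j) < rho j) /\
     forall j e, valid j e y ->
       shifted_log j e y <= - m0 \/ exists2 k,
         J k & shifted_log j e y <= shifted_log k e y.
  have n3 : nbhs z0 (Omega `&` [set y | d z0 / 2 < d y] `&` A).
    by apply: filterI; [apply: filterI|].
  have [s s0 hs] := (nbhs_enormP _ _).1 n3.
  exists J, (Num.min s (d z0 / 2)); split; first by rewrite lt_min s0.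
  move=> y; rewrite lt_min => /andP[ys _]; have [[Oy dy] Ay] := hs y ys.
  have [h1 h2] := HA y Ay Oy; split=> //.
  by apply: (@le_trans _ _ (d z0 / 2)); [rewrite ge_min lexx orbT|exact: ltW].
have [ez|ez] := ltP e0 (d z0).
  exists (fun _ => False), [set y | e0 < d y].
    by apply: nbhs_gt => //; exact: bdist_continuous.
  by move=> y ey Oy; split=> // j e v; left; apply: shifted_log_deep => //;
    exact: ltW.
have [k zk] := margin (le_lt_trans ez e0_ltg).
pose J j := enorm (z0 - x j) < rho j.
have Jk : J k by rewrite /J; have := g_gt0; lra.
exists J, [set y | forall j, if `[< J j >] then enorm (y - x j) < rho j
                             else 1 < slope * (cutoff k y - cutoff j y)].
  apply: (@filter_forall _ _ _ (nbhs z0) (nbhs_filter z0)) => j;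
    case: asboolP => Jj.
    have := @nbhs_gt _ _ (fun y => - enorm (y - x j)) z0 (- rho j).
    rewrite ltrN2 => H; apply: filterS (H _ Jj) => [y /=|];
      first by rewrite ltrN2.
    by have /cvgN := @edist_point_continuous _ _ (x j) z0.
  apply: (@nbhs_gt _ _ (fun y => slope * (cutoff k y - cutoff j y))).
    exact: cutoff_diff_continuous.
  rewrite !cutoffE opprD addrACA subrr addr0 /slope.
  move: Jj => /negP; rewrite -leNgt => zj.
  have zk0 := enorm_ge0 (z0 - x k).
  have h1 : rho j ^+ 2 <= enorm (z0 - x j) ^+ 2.
    by apply: lerXn2r; rewrite ?nnegrE ?enorm_ge0// ltW.
  have h2 : enorm (z0 - x k) ^+ 2 <= (rho k - g) ^+ 2.
    by apply: lerXn2r; rewrite ?nnegrE ?enorm_ge0 ?(ltW zk)// ltW//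
      (le_lt_trans zk0).
  have g2 : 0 < g ^+ 2 by rewrite exprn_gt0.
  rewrite -(@ltr_pM2r _ (g ^+ 2))// mul1r mulrAC divfK ?gt_eqF//.
  have h3 : 0 < g * (rho k - g) by rewrite mulr_gt0// (le_lt_trans zk0).
  have h4 : rho k ^+ 2 - (rho k - g) ^+ 2 = g ^+ 2 + 2 * (g * (rho k - g)) by
    ring.
  lra.
move=> y Ay Oy; split=> [j Jj|j e v].
  by have := Ay j; rewrite asboolT.
right; case: (pselect (J j)) => Jj; first by exists j.
exists k => //; have [yj e_0 ee0 o1] := v.
apply: shifted_log_dominated => //; first by have := Ay k; rewrite asboolT.
  exact: e0_range.
by have := Ay j; rewrite asboolF// => /ltW.
Qed.

Definition values z : set R :=
  [set v | v = - m0 \/ exists j e, valid j e z /\ v = shifted_log j e z].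

(** The value 0 off [Omega] is the boundary value. *)
Definition exhaustion z : R := if `[< Omega z >] then sup (values z) else 0.

Lemma shifted_log_le0 j e z : Omega z -> valid j e z -> shifted_log j e z <= 0.
Proof.
move=> Oz [zj e_0 ee0 o1]; have ee := e0_range e_0 ee0.
apply: le_trans (shifted_log_upper Oz zj ee) _; rewrite oppr_le0.
have L := lnV_gt0 ee; have /andP[f0 _] := f_bounds ee.
have dz := bdist_gt0 oO b0 Oz.
by rewrite divr_ge0 ?(ltW L)// ln_ge0// lerDl divr_ge0// ltW.
Qed.

Lemma values_ub z : Omega z -> ubound (values z) 0.
Proof.
move=> Oz _ [->|[j [e [v ->]]]]; first by rewrite oppr_le0 ltW.
exact: shifted_log_le0.
Qed.

Lemma exhaustion_ge_val z v : Omega z -> values z v -> v <= exhaustion z.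
Proof.
move=> Oz vz; rewrite /exhaustion asboolT//; apply: ub_le_sup => //.
by exists 0; exact: values_ub.
Qed.

Lemma exhaustion_le z (B : R) : Omega z -> - m0 <= B ->
  (forall j e, valid j e z -> shifted_log j e z <= B) -> exhaustion z <= B.
Proof.
move=> Oz mB H; rewrite /exhaustion asboolT//; apply: ge_sup;
  first by exists (- m0); left.
by move=> _ [->//|[j [e [v ->]]]]; exact: H.
Qed.

Lemma exhaustion_ge_m0 z : Omega z -> - m0 <= exhaustion z.
Proof. by move=> Oz; apply: exhaustion_ge_val => //; left. Qed.

Lemma exhaustion_ge j e z : Omega z -> valid j e z ->
  shifted_log j e z <= exhaustion z.
Proof. by move=> Oz v; apply: exhaustion_ge_val => //; right; exists j, e. Qed.

(** A supremum of infinitely many negative values could vanish; [ln_ratio_lower] bounds them away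
    from 0 uniformly in e, since f e < e. *)
Lemma exhaustion_lt0 z : Omega z -> exhaustion z < 0.
Proof.
move=> Oz; have dz := bdist_gt0 oO b0 Oz.
have [m mgt0 hm] := ln_ratio_lower dz e0_gt0 (e_lt1 e0_lt1).
apply: (@le_lt_trans _ _ (- Num.min m m0));
  last by rewrite oppr_lt0 lt_min mgt0.
apply: exhaustion_le => //; first by rewrite lerN2 ge_min lexx orbT.
move=> j e [zj e_0 ee0 o1]; have ee := e0_range e_0 ee0.
apply: le_trans (shifted_log_upper Oz zj ee) _; rewrite lerN2 ge_min;
  apply/orP; left.
apply: le_trans (hm e e_0 ee0) _.
have L := lnV_gt0 ee; have /andP[f0 fe] := f_bounds ee.
rewrite ler_pM2r ?invr_gt0// ler_ln ?posrE ?addr_gt0 ?divr_gt0//.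
by rewrite lerD2l ler_pM2l// lef_pV2 ?posrE// ltW.
Qed.

Lemma lip_const_ge0 (s : R) : 0 < s -> 0 <= lip_const s.
Proof.
move=> s0; have L : 0 < ln e0^-1 by apply: lnV_gt0; rewrite e0_gt0.
apply: addr_ge0; first by rewrite divr_ge0 ?invr_ge0 ?(ltW L) ?(ltW s0).
apply: mulr_ge0; first exact: ltW slope_gt0.
by rewrite mulr_ge0// sumr_ge0// => i _; exact: enorm_ge0.
Qed.

(** Each value at y lies below - m0 or below one whose index is in J; the latter is still a
    candidate at z, so the common Lipschitz bound passes to the supremum. *)
Lemma exhaustion_continuous z0 : Omega z0 ->
  exhaustion y @[y --> z0] --> exhaustion z0.
Proof.
move=> Oz0; have [J [s [s0 hs]]] := local_index Oz0.
have half y z : enorm (y - z0) < s -> enorm (z - z0) < s ->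
    exhaustion y - exhaustion z <= lip_const s * enorm (y - z).
  move=> ys zs; have [Oy dy Jy hy] := hs y ys; have [Oz dz Jz _] := hs z zs.
  have C0 : 0 <= lip_const s * enorm (y - z) by rewrite mulr_ge0 ?enorm_ge0//
    lip_const_ge0.
  have mz := exhaustion_ge_m0 Oz.
  rewrite lerBlDl; apply: exhaustion_le => //; first lra.
  move=> j e v; have [h|[k Jk h]] := hy j e v; first lra.
  have [_ e_0 ee0 o1] := v.
  have vk : valid k e z by split=> //; exact: Jz.
  have h2 := exhaustion_ge Oz vk.
  have := shifted_log_lip s0 Oy Oz (Jy k Jk) (Jz k Jk) dy dz e_0 ee0 o1.
  by rewrite ler_norml => /andP[_ h3]; lra.
apply: (@enorm_lip_cvg _ _ _ _ (lip_const s)).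
apply: (@filterS _ (nbhs z0) (nbhs_filter z0) _ _ _ (nbhs_eball z0 s0)) => y ys.
have zs : enorm (z0 - z0) < s by rewrite subrr enorm0.
rewrite ler_norml half// andbT lerNl opprB enormB; exact: half.
Qed.

(** On a disc small enough to stay near z0, a competitor with index in J is defined everywhere,
    satisfies the mean inequality and lies below the supremum. *)
Lemma exhaustion_local_submean z0 : Omega z0 -> local_submean exhaustion z0.
Proof.
move=> Oz0 b; have [J [s [s0 hs]]] := local_index Oz0.
have B0 : 0 < enorm b + 1 by rewrite ltr_wpDl ?enorm_ge0.
exists (s / (enorm b + 1)); first by rewrite divr_gt0.
move=> r /andP[r0]; rewrite ltr_pdivlMr// => rs.
have zs l : Normc.normc l <= r -> enorm (z0 + l *: b - z0) < s.
  move=> lr; rewrite addrC addKr enormZ; apply: le_lt_trans rs.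
  by apply: ler_pM; rewrite ?normc_ge0 ?enorm_ge0// lerDl.
have OD l : Normc.normc l <= r -> Omega (z0 + l *: b).
  by move=> lr; have [] := hs _ (zs l lr).
have cV := continuous_on_circle exhaustion_continuous (ltW r0) OD.
have Oc t : Omega (z0 + ccirc r t *: b).
  by apply: OD; rewrite normc_ccirc gtr0_norm.
have cm : continuous (fun _ : R => - m0) by move=> ?; exact: cvg_cst.
have mV : - m0 <= cmean (fun t => exhaustion (z0 + ccirc r t *: b)).
  by rewrite -(cmean_cst (- m0)); apply: le_cmean => // t _;
    exact: exhaustion_ge_m0.
have zz : enorm (z0 - z0) < s by rewrite subrr enorm0.
have [_ _ _ h0] := hs z0 zz.
apply: exhaustion_le => // j e v; have [h|[k Jk h]] := h0 j e v;
  first exact: le_trans mV.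
apply: (le_trans h); have [_ e_0 ee0 o1] := v.
have Dk l : Normc.normc l <= r ->
  Omega (z0 + l *: b) /\ enorm (z0 + l *: b - x k) < rho k.
  by move=> lr; have [Ol _ Jl _] := hs _ (zs l lr); split=> //; exact: Jl.
have [h1 cu] := shifted_log_mean r0 e_0 ee0 Dk; apply: (le_trans h1).
apply: le_cmean => // t _; apply: exhaustion_ge => //.
split=> //; have /Dk[] // : Normc.normc (ccirc r t) <= r by rewrite normc_ccirc
  gtr0_norm.
Qed.

Lemma exhaustion_lower z : Omega z -> d z <= e0 ->
  - (ln 2 / ln (d z)^-1) - glue_const * om (d z) <= exhaustion z.
Proof.
move=> Oz dz0; have dz := bdist_gt0 oO b0 Oz.
have [k zk] := margin (le_lt_trans dz0 e0_ltg).
have ee := e0_range dz dz0; have L := lnV_gt0 ee.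
have C1 := glue_const_ge1 k Oz; have O1 := om_gt0 ee.
have q2 : 0 <= ln 2 / ln (d z)^-1 by rewrite divr_ge0 ?(ltW L)// ln_ge0// ler1n.
(* If omega exceeds 1, then e = delta z is not a valid parameter, but the claimed bound is below - 1
   <= - m0. *)
have [le1|gt1] := leP (om (d z)) 1; last first.
  apply: le_trans (exhaustion_ge_m0 Oz).
  have h : 1 * 1 <= glue_const * om (d z) by apply: ler_pM => //; exact: ltW.
  by move: h; set X := glue_const * _; have := m0_le1; lra.
have zk' : enorm (z - x k) < rho k by have := g_gt0; lra.
have v : valid k (d z) z by split.
apply: le_trans (exhaustion_ge Oz v);
  apply: le_trans (shifted_log_lower Oz zk' ee).
rewrite lerD2r.
have -> : ln (d z + d z) = ln 2 - ln (d z)^-1.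
  by rewrite lnV ?posrE// opprK -lnM ?posrE// mulr_natl mulr2n.
rewrite le_eqVlt; apply/orP; left; apply/eqP; field; rewrite gt_eqF//.
Qed.

Lemma exhaustion_outside z : ~ Omega z -> exhaustion z = 0.
Proof. by move=> nO; rewrite /exhaustion asboolF. Qed.

Lemma exhaustion_psh : psh Omega (EFin \o exhaustion).
Proof. exact: (local_submean_psh exhaustion_continuous
  exhaustion_local_submean). Qed.

Lemma exhaustion_upper z (B : R) : Omega z -> - m0 <= B ->
  (forall e, 0 < e -> e <= e0 -> - (ln (1 + d z / f e) / ln e^-1) <= B) ->
    exhaustion z <= B.
Proof.
move=> Oz mB H; apply: exhaustion_le => // j e [zj e_0 ee0 _].
by apply: le_trans (shifted_log_upper Oz zj (e0_range e_0 ee0)) _; exact: H.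
Qed.

Lemma lower_cvg (eta : R) : 0 < eta ->
  exists2 tau : R, 0 < tau & forall t : R, 0 < t -> t < tau ->
  ln 2 / ln t^-1 + glue_const * om t < eta.
Proof.
move=> eta0; have C0 : 0 < `|glue_const| + 1 by rewrite ltr_wpDl.
have h0 : 0 < eta / 2 by rewrite divr_gt0.
have h1 : 0 < eta / 2 / (`|glue_const| + 1) by rewrite divr_gt0.
have l2 : 0 < ln 2 :> R by apply: ln_gt0; rewrite ltr1n.
have [a a0 ha] : exists2 a : R, 0 < a & forall t : R, 0 < t -> t < a ->
    om t < eta / 2 / (`|glue_const| + 1).
  have [a /= a0 ha] := (@real_cvgP _ _ _ _ _ _).1 om_cvg _ h1.
  exists a => // t t0 ta; have := ha t;
    rewrite /= sub0r normrN gtr0_norm// subr0.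
  by move=> /(_ ta t0); rewrite ltr_norml => /andP[].
exists (Num.min (Num.min a e1) (expR (- (2 * ln 2 / eta)))).
  by rewrite !lt_min a0 expR_gt0 andbT/= (lt_trans e0_gt0).
move=> t t0; rewrite !lt_min => /andP[/andP[ta te1] tE].
have ee : 0 < t < e1 by rewrite t0.
have L := lnV_gt0 ee; have O1 := om_gt0 ee.
have h2 : ln 2 / ln t^-1 < eta / 2.
  rewrite ltr_pdivrMr// mulrC -ltr_pdivrMr//.
  have -> : ln 2 / (eta / 2) = 2 * ln 2 / eta by field; rewrite gt_eqF.
  by rewrite lnV ?posrE// ltrNr -[ltRHS]expRK ltr_ln ?posrE ?expR_gt0.
have h3 : glue_const * om t < eta / 2.
  apply: (@le_lt_trans _ _ ((`|glue_const| + 1) * om t)).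
    by rewrite ler_pM2r//; have := ler_norm glue_const; lra.
  by rewrite mulrC -ltr_pdivlMr//; exact: ha.
by move: h2 h3; set X := ln 2 / _; set Y := glue_const * _; lra.
Qed.

Lemma exhaustion_continuous_boundary z : boundary Omega z ->
  exhaustion y @[y --> z] --> exhaustion z.
Proof.
move=> bz; have nz : ~ Omega z by move: bz; rewrite open_boundaryE// => -[].
apply: (@real_cvgP _ _ (nbhs z) (nbhs_filter z) _ _).2 => eta eta0.
have [tau tau0 htau] := lower_cvg eta0.
have r0 : 0 < Num.min tau e0 by rewrite lt_min tau0.
apply: (@filterS _ (nbhs z) (nbhs_filter z) _ _ _ (nbhs_eball z r0)) => y.
rewrite /eball /= lt_min => /andP[yt ye]; rewrite (exhaustion_outside nz) subr0.
case: (pselect (Omega y)) => Oy; last by rewrite exhaustion_outside// normr0.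
have dy : d y <= enorm (y - z) by exact: edist_le.
have dy0 := bdist_gt0 oO b0 Oy.
have h1 := exhaustion_lower Oy (le_trans dy (ltW ye)).
have h2 := htau _ dy0 (le_lt_trans dy yt).
rewrite ltr0_norm ?exhaustion_lt0// ltrNl; apply: lt_le_trans h1.
by rewrite -opprD ltrN2.
Qed.

Lemma exhaustion_bounded_psh : bounded_psh_exhaustion Omega exhaustion.
Proof.
split; first exact: exhaustion_psh.
- apply: continuous_in_subspaceT => z /set_mem cz.
  case: (pselect (Omega z)) => Oz; first exact: exhaustion_continuous.
  by apply: exhaustion_continuous_boundary; rewrite open_boundaryE.
- exact: exhaustion_lt0.
- by move=> z; rewrite open_boundaryE// => -[_]; exact: exhaustion_outside.
Qed.

End Construction.

(** * Choice of the endpoint *)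

Section Endpoint.
Variable R : realType.
Implicit Types (f : R -> R) (e t : R).

(** With s = sqrt k, the difference 1 + s^2 a - s (1 + a) factors as (s - 1) (s a - 1). *)
Lemma sqrt_ratio (a k : R) : 1 <= a -> 1 <= k ->
  ln k / 2 + ln (1 + a) <= ln (1 + k * a).
Proof.
move=> a1 k1; pose s := Num.sqrt k.
have s2 : s ^+ 2 = k by rewrite sqr_sqrtr//; lra.
have s1 : 1 <= s by rewrite -(@sqrtr1 R) ler_wsqrtr.
have s0 : 0 < s by lra.
have -> : ln k / 2 = ln s.
  by rewrite -s2 expr2 lnM ?posrE//; field.
rewrite -lnM ?posrE//; last lra.
rewrite ler_ln ?posrE; last 2 first.
- by rewrite mulr_gt0//; lra.
- by rewrite addr_gt0// mulr_gt0//; lra.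
rewrite -s2 -subr_ge0.
have -> : 1 + s ^+ 2 * a - s * (1 + a) = (s - 1) * (s * a - 1) by ring.
apply: mulr_ge0; first lra.
by rewrite subr_ge0 mulr_ege1.
Qed.

(** Convexity of the k-th power between 1 and 1 + a. It reduces the comparison of barriers at
    distance t <= e0 to the distance e0. *)
Lemma ln1p_convex (a b k t : R) : 0 <= a -> 0 <= b -> 1 <= k -> 0 <= t <= 1 ->
  k * ln (1 + a) <= ln (1 + b) -> k * ln (1 + t * a) <= ln (1 + t * b).
Proof.
move=> a0 b0 k1 /andP[t0 t1] H.
have ta : 0 <= t * a by rewrite mulr_ge0.
have tb : 0 <= t * b by rewrite mulr_ge0.
have h1 : (1 + a) `^ k <= 1 + b.
  by rewrite -ler_ln ?posrE ?powR_gt0//; try lra; rewrite ln_powR.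
rewrite -ln_powR ler_ln ?posrE ?powR_gt0//; try lra.
have := @convex_powR R k k1 (Itv01 t0 t1) (1 + a) 1.
rewrite !inE/= !in_itv/= !andbT ler01 addr_ge0// => /(_ isT isT).
rewrite !convRE /= powR1 => h2.
have -> : 1 + t * a = t * (1 + a) + (1 - t) * 1 by ring.
apply: (le_trans h2).
have : t * (1 + a) `^ k <= t * (1 + b) by rewrite ler_wpM2l.
by rewrite -[X in _ + X <= _]/((1 - t) * 1); lra.
Qed.

(* [e0] minimizes [omega f e + ln (ln e^-1) / 2]. *)
Lemma good_endpoint f (eps1 eps0 : R) : 0 < eps0 -> eps0 < eps1 -> eps1 < 1 ->
  admissible eps1 f -> (forall s t : R, 0 <= s -> s <= t -> f s <= f t) ->
  exists2 e0 : R, 0 < e0 <= eps0 &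
    ln (1 + e0 / f e0) / ln e0^-1 <= 1 /\
    forall t e, 0 < t -> t <= e0 -> 0 < e -> e <= e0 ->
      ln (1 + t / f e0) / ln e0^-1 <= ln (1 + t / f e) / ln e^-1.
Proof.
move=> eps00 eps01 eps11 [cf fge om0 omc] mono.
have l2 : 0 < ln 2 :> R by apply: ln_gt0; rewrite ltr1n.
have [a1 a10 ha1] : exists2 a : R, 0 < a & forall e, 0 < e -> e < a ->
  omega f e < 1 / 8.
  have h8 : 0 < 1 / 8 :> R by lra.
  have [a /= a0 ha] := (@real_cvgP _ _ _ _ _ _).1 omc _ h8.
  exists a => // t t0 ta; have := ha t;
    rewrite /= sub0r normrN gtr0_norm// subr0.
  by move=> /(_ ta t0); rewrite ltr_norml => /andP[].
(* Up to a, omega is below 1 / 8 and ln 2 is at most an eighth of ln e^-1; together they give the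
   quarter in [lnA]. *)
pose a := Num.min (Num.min eps0 (a1 / 2)) (expR (- (8 * ln 2))).
have a0 : 0 < a by rewrite !lt_min eps00 divr_gt0//= expR_gt0.
have aeps : a <= eps0 by rewrite !ge_min lexx.
have aa1 : a < a1.
  by rewrite !gt_min; apply/orP; left; apply/orP; right;
    rewrite ltr_pdivrMr// ltr_pMr// ltr1n.
have aE : a <= expR (- (8 * ln 2)) by rewrite ge_min lexx orbT.
clearbody a.
have rng e : 0 < e -> e <= a -> 0 < e < eps1.
  by move=> -> ea /=; apply: le_lt_trans eps01; exact: le_trans aeps.
have Lge e : 0 < e -> e <= a -> 8 * ln 2 <= ln e^-1.
  move=> e0 ea; rewrite lnV ?posrE// lerNr -[leRHS]expRK ler_ln ?posrE
    ?expR_gt0//.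
  exact: le_trans aE.
have Lpos e : 0 < e -> e <= a -> 0 < ln e^-1.
  by move=> e0 ea; apply: lt_le_trans (Lge e e0 ea); rewrite mulr_gt0.
pose h e := omega f e + ln (ln e^-1) / 2.
(* For e < eta the double logarithm alone makes h e exceed h a, so the minimum over [eta, a] is the
   minimum over all 0 < e <= a. *)
pose eta := Num.min a (expR (- expR (2 * h a))).
have eta0 : 0 < eta by rewrite lt_min a0 expR_gt0.
have etaa : eta <= a by rewrite ge_min lexx.
have cfe e : 0 < e -> f y @[y --> e] --> f e.
  move=> e0; move: cf => /continuous_within_itvcyP[cf _].
  by apply: cf; rewrite in_itv/= e0.
have fpos e : 0 < e -> e <= a -> 0 < f e.
  by move=> ep ea; have /andP[] := f_bounds eps11 fge om0 (rng e ep ea).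
have clnV e : 0 < e -> ln y^-1 @[y --> e] --> ln e^-1.
  move=> e0; apply: (@continuous_comp _ _ _ (fun y : R => y^-1) (@ln R)).
    by apply: inv_continuous; rewrite gt_eqF.
  by apply: continuous_ln; rewrite invr_gt0.
have ch : {within `[eta, a], continuous h}.
  apply: continuous_in_subspaceT => e /set_mem /=;
    rewrite in_itv/= => /andP[ee ea].
  have e0 : 0 < e by exact: lt_le_trans ee.
  have L := Lpos e e0 ea.
  apply: cvgD.
    apply: cvgM; last by apply: cvgV; [rewrite gt_eqF|exact: clnV].
    apply: (@continuous_comp _ _ _ (fun y : R => y / f y) (@ln R)).
      by apply: cvgM; [exact: cvg_id|apply: cvgV;
        [rewrite gt_eqF// fpos|exact: cfe]].
    by apply: continuous_ln; rewrite divr_gt0// fpos.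
  apply: cvgM; last exact: cvg_cst.
  apply: (@continuous_comp _ _ _ (fun y : R => ln y^-1) (@ln R));
    first exact: clnV.
  exact: continuous_ln.
have [e0 /[!in_itv]/= /andP[e0eta e0a] hmin] := EVT_min etaa ch.
have e00 : 0 < e0 by exact: lt_le_trans e0eta.
have {}hmin e : 0 < e -> e <= a -> h e0 <= h e.
  move=> ep ea; have [et|et] := leP eta e; first by apply: hmin;
    rewrite in_itv/= et.
  have h1 : h e0 <= h a by apply: hmin; rewrite in_itv/= lexx etaa.
  have L := Lpos e ep ea.
  apply: (le_trans h1); rewrite /h -/(h a).
  have ome := om0 e (rng e ep ea).
  have : h a < ln (ln e^-1) / 2.
    rewrite ltr_pdivlMr// mulrC -ltr_expR lnK ?posrE// lnV ?posrE//.
    rewrite ltrNr -[ltRHS]expRK ltr_ln ?posrE ?expR_gt0//.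
    by apply: lt_le_trans et _; rewrite ge_min lexx orbT.
  by lra.
exists e0; first by rewrite e00 (le_trans e0a).
have r0 := rng e0 e00 e0a; have M0 := Lpos e0 e00 e0a;
  have M8 := Lge e0 e00 e0a.
have o0 : omega f e0 < 1 / 8 by apply: ha1 => //; exact: le_lt_trans aa1.
have o0p := om0 _ r0.
have lnF := ln_f eps11 fge om0 r0.
have /andP[F0 Fe] := f_bounds eps11 fge om0 r0.
have A1 : 1 <= e0 / f e0 by rewrite ler_pdivlMr// mul1r ltW.
have oM := omE f eps11 r0.
have o8 : omega f e0 * ln e0^-1 <= 1 / 8 * ln e0^-1 by rewrite ler_wpM2r// ltW.
have lnA : ln (1 + e0 / f e0) <= ln e0^-1 / 4.
  apply: (@le_trans _ _ (ln (2 * (e0 / f e0)))).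
    by rewrite ler_ln ?posrE; lra.
  by rewrite lnM ?posrE//; [rewrite -oM; lra|lra].
split; first by rewrite ler_pdivrMr// mul1r; lra.
move=> t e t0 te ep ee0.
have ea : e <= a by exact: le_trans e0a.
have re := rng e ep ea; have L0 := Lpos e ep ea; have oe := om0 _ re.
have lnG := ln_f eps11 fge om0 re.
have /andP[G0 _] := f_bounds eps11 fge om0 re.
have GF : f e <= f e0 by apply: mono => //; exact: ltW.
have hm := hmin e ep ea.
pose k := ln e^-1 / ln e0^-1.
have LE : ln e^-1 = k * ln e0^-1 by rewrite /k divfK// gt_eqF.
have k1 : 1 <= k.
  rewrite ler_pdivlMr// mul1r ler_ln ?posrE ?invr_gt0//.
  by rewrite lef_pV2 ?posrE.
have k0 : 0 < k by lra.
have lk : ln k <= k - 1.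
  by have := @le_ln1Dx R (k - 1); rewrite (_ : 1 + (k - 1) = k); [apply;
    lra|ring].
(* Passing from e0 to e changes the double logarithm by ln k <= k - 1; the weight in h was chosen so
   that minimality yields this bound. *)
have od : omega f e0 - omega f e <= (k - 1) / 2.
  move: hm; rewrite /h LE lnM ?posrE//; lra.
have S := @sqrt_ratio (e0 / f e0) (f e0 / f e) A1.
have kk1 : 1 <= f e0 / f e by rewrite ler_pdivlMr// mul1r.
have {S} := S kk1.
have -> : f e0 / f e * (e0 / f e0) = e0 / f e by field; rewrite !gt_eqF.
rewrite ln_div ?posrE// lnF lnG LE => S.
(* The case t = e0. Half of the gain (k - 1) ln e0^-1 / 2 may be lost to the omega terms; the other
   half covers (k - 1) ln (1 + e0 / f e0) by [lnA]. *)
have key : k * ln (1 + e0 / f e0) <= ln (1 + e0 / f e).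
  apply: le_trans S.
  have h1 : (k - 1) * ln (1 + e0 / f e0) <= (k - 1) * (ln e0^-1 / 4).
    by rewrite ler_wpM2l// subr_ge0.
  have h2 : omega f e <= omega f e * k by rewrite ler_peMr// ltW.
  have h3 : (omega f e0 - omega f e * k) * ln e0^-1 <= (k - 1) / 2 * ln e0^-1.
    by rewrite ler_wpM2r ?(ltW M0)//; lra.
  rewrite -subr_ge0.
  have -> : (- (1 + omega f e0) * ln e0^-1 - - (1 + omega f e) * (k * ln
    e0^-1)) / 2 +
     ln (1 + e0 / f e0) - k * ln (1 + e0 / f e0) =
     ((k - 1) * ln e0^-1 - (omega f e0 - omega f e * k) * ln e0^-1) / 2
       - (k - 1) * ln (1 + e0 / f e0) by field.
  by lra.
rewrite ler_pdivrMr// invfM mulrA divfK ?gt_eqF// ler_pdivlMr// mulrC.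
have -> : t / f e0 = (t / e0) * (e0 / f e0) by field; rewrite !gt_eqF.
have -> : t / f e = (t / e0) * (e0 / f e) by field; rewrite !gt_eqF.
apply: ln1p_convex => //; first lra.
  by rewrite divr_ge0// ltW.
by rewrite divr_ge0 ?(ltW t0) ?(ltW e00)//= ler_pdivrMr// mul1r.
Qed.

End Endpoint.

(** * Choice of the constants and the two estimates *)

Theorem theorem3 (R : realType) (n : nat) (Omega : set (Cn R n))
    (bounded_Omega : ebounded Omega) (domain_Omega : domain Omega)
    (N : nat) (x : 'I_N -> Cn R n) (r : 'I_N -> R) (w : 'I_N -> Cn R n)
    (C0_Omega : C0_boundary_data Omega x r w)
    (c eps1 : R) (c_ge1 : 1 <= c) (eps1_gt0 : 0 < eps1) (eps1_lt1 : eps1 < 1)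
    (cover : boundary Omega `<=` \bigcup_j eball (x j) (r j / c))
    (pseudoconvex_Omega : pseudoconvex Omega) :
  exists eps0 C1 : R,
    [/\ 0 < eps0, eps0 <= eps1, 0 < C1 &
    forall f : R -> R,
      admissible eps1 f ->
      boundary_growth Omega x r w c eps1 f ->
      [/\ hyperconvex Omega,
          exists2 v : Cn R n -> R, bounded_psh_exhaustion Omega v &
            forall z, Omega z -> bdist Omega z <= eps0 ->
              - (ln 2 / ln (bdist Omega z)^-1) - C1 * omega f (bdist Omega z)
                <= v z &
          (forall s t : R, 0 <= s -> s <= t -> f s <= f t) ->
          exists (e0 : R) (v : Cn R n -> R),
            [/\ 0 < e0 <= eps0,
                bounded_psh_exhaustion Omega v,
                forall z, Omega z -> bdist Omega z <= e0 ->
                  - (ln 2 / ln (bdist Omega z)^-1)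
                    - C1 * omega f (bdist Omega z) <= v z &
                forall z, Omega z -> bdist Omega z < e0 ->
                  v z <= ln (f e0 / (bdist Omega z + f e0)) / ln e0^-1]]].
Proof.
have [oO _] := domain_Omega.
have [chart _] := C0_Omega.
have rho_gt0 j : 0 < r j / c.
  by have [_ rj _] := chart j; rewrite divr_gt0// (lt_le_trans ltr01).
(* An empty [Omega] counts as a domain; the zero function then satisfies every clause. *)
have [[zs Ozs]|Oempty] := pselect (exists z, Omega z); last first.
  have vac z : Omega z -> False by move=> Oz; apply: Oempty; exists z.
  have H0 : bounded_psh_exhaustion Omega (fun=> 0).
    split=> //.
    - by apply: local_submean_psh => z /vac.
    - by apply: continuous_subspaceT; exact: cst_continuous.
    - by move=> z /vac.
  exists eps1, 1; split=> // f adm gr; split; first by exists (fun=> 0).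
    by exists (fun=> 0) => // z /vac.
  move=> _; exists eps1, (fun=> 0); split=> //; first by rewrite eps1_gt0 lexx.
    by move=> z /vac.
  by move=> z /vac.
have b0 := boundary_nonempty oO bounded_Omega Ozs.
have [M OM] := bounded_Omega.
have bnd z : Omega z -> enorm z < M by move=> /OM; rewrite /eball /= subr0.
have [g g_gt0 margin] := boundary_cover_margin bounded_Omega b0 cover.
pose rho j := r j / c.
pose C1 := glue_const x rho g M.
have C1_ge1 : 1 <= C1.
  have [y by_] := b0.
  have [k _] : exists k, enorm (y - x k) < r k / c - g.
    by apply: margin; rewrite bdist_boundary.
  exact: (@glue_const_ge1 _ _ Omega _ _ _ _ _ g_gt0 bnd zs k Ozs).
have C1_gt0 : 0 < C1 by exact: lt_le_trans C1_ge1.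
(* Halving makes [eps0] strictly smaller than both [eps1] and the margin g, as the construction
   requires of its endpoint. *)
pose eps0 := Num.min eps1 g / 2.
have m_gt0 : 0 < Num.min eps1 g by rewrite lt_min eps1_gt0.
have eps0_gt0 : 0 < eps0 by rewrite divr_gt0.
have eps0_ltm : eps0 < Num.min eps1 g by rewrite ltr_pdivrMr// ltr_pMr// ltr1n.
have [eps0_lt1 eps0_ltg] : eps0 < eps1 /\ eps0 < g.
  by move: eps0_ltm; rewrite lt_min => /andP[].
exists eps0, C1; split=> //; first exact: ltW.
move=> f adm gr; have [cf f_ge0 om_gt0 om_cvg] := adm.
(* Applied twice: with endpoint [eps0] for every admissible f, and with the endpoint of
   [good_endpoint] for monotone f. [C1] involves neither e0 nor m0, so it is the same both times. *)
have build e0 m0 : 0 < e0 -> e0 <= eps0 -> 0 < m0 -> m0 <= 1 ->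
    (forall e, 0 < e -> e <= e0 -> m0 <= ln (1 + e0 / f e) / ln e^-1) ->
    exists v, [/\ bounded_psh_exhaustion Omega v,
      forall z, Omega z -> bdist Omega z <= e0 ->
        - (ln 2 / ln (bdist Omega z)^-1) - C1 * omega f (bdist Omega z) <= v z &
      forall z B, Omega z -> - m0 <= B ->
        (forall e, 0 < e -> e <= e0 ->
          - (ln (1 + bdist Omega z / f e) / ln e^-1) <= B) ->
        v z <= B].
  move=> e0_gt0 e0_le m0_gt0 m0_le1 m0_le.
  have e0_lt1 := le_lt_trans e0_le eps0_lt1;
    have e0_ltg := le_lt_trans e0_le eps0_ltg.
  exists (exhaustion Omega x w rho f e0 m0 g M); split.
  - exact: (@exhaustion_bounded_psh _ _ _ _ _ _ _ _ eps1).
  - exact: (@exhaustion_lower _ _ _ _ _ _ _ _ eps1).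
  - exact: (@exhaustion_upper _ _ _ _ _ _ _ _ eps1).
(* This bound has e in place of f e; since f e < e, it also holds for the ratio that [build]
   needs. *)
have [m m0 hm] := ln_ratio_lower eps0_gt0 eps0_gt0 (lt_trans eps0_lt1 eps1_lt1).
have [v [v1 v2 _]] : exists v, [/\ bounded_psh_exhaustion Omega v,
      forall z, Omega z -> bdist Omega z <= eps0 ->
        - (ln 2 / ln (bdist Omega z)^-1) - C1 * omega f (bdist Omega z) <= v z
            & True].
  have p1 : 0 < Num.min m 1 by rewrite lt_min m0 ltr01.
  have p2 : Num.min m 1 <= 1 by rewrite ge_min lexx orbT.
  have [e e_0 ee0|v [v1 v2 _]] := build eps0 _ eps0_gt0 (lexx _) p1 p2;
    last by exists v.
  rewrite ge_min; apply/orP; left; apply: le_trans (hm e e_0 ee0) _.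
  have ee : 0 < e < eps1 by rewrite e_0 (le_lt_trans ee0).
  have L := lnV_gt0 eps1_lt1 ee;
    have /andP[f0 fe] := f_bounds eps1_lt1 f_ge0 om_gt0 ee.
  rewrite ler_pM2r ?invr_gt0// ler_ln ?posrE ?addr_gt0 ?divr_gt0//.
  by rewrite lerD2l ler_pM2l// lef_pV2 ?posrE// ltW.
split; [by exists v|by exists v|move=> mono].
have [e0 /andP[e0_gt0 e0_le] [q1 hq]] := good_endpoint eps0_gt0 eps0_lt1
  eps1_lt1 adm mono.
have ee : 0 < e0 < eps1 by rewrite e0_gt0 (le_lt_trans e0_le).
have L := lnV_gt0 eps1_lt1 ee;
  have /andP[f0 fe] := f_bounds eps1_lt1 f_ge0 om_gt0 ee.
(* The truncation level is the barrier at distance e0 and parameter e0, so - m0 lies below the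
   desired upper bound wherever delta z < e0. *)
have [|v' [v'1 v'2 v'3]] := build e0 _ e0_gt0 e0_le _ q1 (fun e h1 h2 =>
  hq e0 e e0_gt0 (lexx _) h1 h2).
  by rewrite divr_gt0// ln_gt0// ltrDl divr_gt0.
exists e0, v'; split=> //; first by rewrite e0_gt0.
move=> z Oz ze; have dz := bdist_gt0 oO b0 Oz.
have -> : ln (f e0 / (bdist Omega z + f e0)) / ln e0^-1 =
    - (ln (1 + bdist Omega z / f e0) / ln e0^-1).
  rewrite -mulNr -lnV ?posrE ?addr_gt0 ?divr_gt0//; congr (ln _ / _).
  by field; rewrite !gt_eqF// ?addr_gt0//.
apply: v'3 => //.
  rewrite lerN2 ler_pM2r ?invr_gt0// ler_ln ?posrE ?addr_gt0 ?divr_gt0//.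
  by rewrite lerD2l ler_pM2r ?invr_gt0// ltW.
move=> e e_0 ee0; rewrite lerN2; apply: hq => //; exact: ltW.
Qed.
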